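(* Let $(\mathbb Z^d,a)$, $d\ge3$, be a uniformly elliptic graph. Then for all finite subsets $A$ of $\mathbb Z^d$ and for all $y\in A$, the limit $\lim_{D(x,A)\to\infty}\overline H_A(x,y)$ exists. Moreover, $$\lim_{|x|\to+\infty}\overline H_A(x,y)=\lim_{m\to+\infty}H_A^m(y),\qquad H_A^m(y)=\frac{\pi(y)\,P_y(\tau_A>\tau_{\partial B(0,m)})}{\mathrm{Cap}_m(A)},$$ where $\mathrm{Cap}_m(A)$ is the capacity of $A$ with respect to $B(0,m)$ (for $m$ large enough).
   Context: $(\mathbb Z^d,a)$ is the lattice $\mathbb Z^d$ with nearest-neighbour edges ($x\sim y$ iff $|x-y|_1=1$) and symmetric weights $a(x,y)=a(y,x)$, with $a(x,y)=0$ if $x,y$ are not nearest neighbours. It is uniformly elliptic if there is a constant $c\ge1$ such that $c^{-1}\le a(e)\le c$ for all edges $e$. Put $\pi(x)=\sum_ya(x,y)$. The random walk $(X_k)_{k\ge0}$ is the Markov chain with transition probabilities $p(x,y)=a(x,y)/\pi(x)$, with law $P_x$ started at $x$. $D$ is the graph distance, $D(x,A)=\inf_{y\in A}D(x,y)$, $B(x,R)=\{y:D(x,y)<R\}$, and $\partial B=\{y\notin B:\exists x\in B,\ x\sim y\}$. $\tau_A=\inf\{k\ge1:X_k\in A\}$, $\overline\tau_A=\inf\{k\ge0:X_k\in A\}$ ($\inf\emptyset=\infty$), and $\overline H_A(x,y)=P_x(X_{\tau_A}=y\mid\tau_A<\infty)$ for $y\in A$. For $A\subset B$, the capacity of $A$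 with respect to $B$ is $\mathrm{Cap}_B(A)=\sum_{x\in A}\pi(x)P_x(\overline\tau_{B^c}<\tau_A)$. *)

(* Defs.v *)
From HB Require Import structures.
From mathcomp Require Import all_boot all_order all_algebra.
From mathcomp Require Import all_classical all_reals all_analysis.
Set Implicit Arguments.
Unset Strict Implicit.
Unset Printing Implicit Defensive.
Import Order.TTheory GRing.Theory Num.Theory.
Import numFieldNormedType.Exports.
Local Open Scope classical_set_scope.
Local Open Scope ring_scope.

Definition norm1 (d : nat) (x : 'rV[int]_d) : int := \sum_(i < d) `|x 0 i|.

Definition nneighbour (d : nat) : rel 'rV[int]_d :=
  fun x y => norm1 (x - y) == 1.

Section graph.
Variables (R : realType) (d : nat).
Implicit Types (a : 'rV[int]_d -> 'rV[int]_d -> R) (x y : 'rV[int]_d)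
  (A B : set 'rV[int]_d).

Definition symmetric_weights a := forall x y, a x y = a y x.

Definition nn_supported a := forall x y, ~~ nneighbour x y -> a x y = 0.

Definition uniformly_elliptic a :=
  exists2 c : R, 1 <= c &
    forall x y, nneighbour x y -> c^-1 <= a x y /\ a x y <= c.

(* A finitely supported sum as soon as [nn_supported a] holds. *)
Definition vweight a x : R := \sum_(y \in [set: 'rV[int]_d]) a x y.

Definition transition a x y : R := a x y / vweight a x.

Definition gdist x y : \bar R :=
  ereal_inf [set (size p)%:R%:E |
    p in [set p : seq 'rV[int]_d | path (@nneighbour d) x p /\ last x p = y]].

Definition gdist_set x A : \bar R := ereal_inf [set gdist x y | y in A].

Definition gball x (r : R) : set 'rV[int]_d := [set y | (gdist x y < r%:E)%E].

Definition gboundary B : set 'rV[int]_d :=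
  [set y | ~ B y /\ exists2 x, B x & nneighbour x y].

(* The filter of "g(x) -> +oo" on the lattice. *)
Definition tends_to_pinfty (g : 'rV[int]_d -> \bar R) :
    set_system 'rV[int]_d :=
  filter_from [set: R] (fun M => [set x | (M%:E < g x)%E]).

End graph.

Section walk.
Context {R : realType} {d : nat} {disp : measure_display}
  {T : measurableType disp}.
Implicit Types (a : 'rV[int]_d -> 'rV[int]_d -> R)
  (P : 'rV[int]_d -> probability T R) (X : nat -> T -> 'rV[int]_d)
  (A B : set 'rV[int]_d) (x y : 'rV[int]_d).

Record random_walk a P X : Prop := RandomWalk {
  walk_measurable : forall k (S : set 'rV[int]_d),
    measurable (X k @^-1` S) ;
  walk_start : forall x, P x [set w | X 0%N w = x] = 1%E ;
  walk_markov : forall x n (s : nat -> 'rV[int]_d),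
    P x [set w | forall i, (i <= n.+1)%N -> X i w = s i] =
    (P x [set w | forall i, (i <= n)%N -> X i w = s i] *
      (transition a (s n) (s n.+1))%:E)%E
}.

(* Times lie in [\bar R], with [ereal_inf set0 = +oo]. *)
Definition hit_from (k0 : nat) X A (w : T) : \bar R :=
  ereal_inf [set k%:R%:E | k in [set k : nat | (k0 <= k)%N /\ A (X k w)]].

Definition tau X A := hit_from 1 X A.

Definition tau_bar X A := hit_from 0 X A.

Definition prob (Q : probability T R) (E : set T) : R := fine (Q E).

Definition cond_prob (Q : probability T R) (E F : set T) : R :=
  prob Q (E `&` F) / prob Q F.

(* The event X_{tau_A} = y; it is only satisfied when tau_A is finite. *)
Definition hits_at X A y : set T :=
  [set w | exists2 k : nat, tau X A w = k%:R%:E & X k w = y].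

Definition Hbar P X A x y : R :=
  cond_prob (P x) (hits_at X A y) [set w | (tau X A w < +oo)%E].

Definition capacity a P X B A : R :=
  \sum_(x \in A) vweight a x *
    prob (P x) [set w | (tau_bar X (~` B) w < tau X A w)%E].

Definition Hm a P X A (m : nat) y : R :=
  vweight a y *
    prob (P y) [set w | (tau X (gboundary (gball 0 (m%:R : R))) w
                         < tau X A w)%E]
  / capacity a P X (gball 0 (m%:R : R)) A.

End walk.

(* Main.v *)
Require Import Defs.
From HB Require Import structures.
From mathcomp Require Import all_boot all_order all_algebra.
From mathcomp Require Import all_classical all_reals all_analysis.
From mathcomp Require Import ring lra zify.
Import Order.TTheory GRing.Theory Num.Theory.
Import numFieldNormedType.Exports.
Local Open Scope classical_set_scope.
Local Open Scope ring_scope.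

(* Everything rests on one fact: G(z, x) / G(z', x) -> 1 as x goes to infinity,
   for the Green function G of the walk, which is finite as d >= 3.  Indeed,
   decomposing at the first visit to A expresses P_x(X_{tau_A} = y), for x outside
   A, as a combination of the G(x, z), z in A, with coefficients
   1_{z = y} - P_z(X_{tau_A} = y).  After division by G(y, x) / pi(x),
   reversibility pi(x) G(x, z) = pi(z) G(z, x) gives numerators and denominators
   converging to pi(y) P_y(tau_A = oo) and \sum_z pi(z) P_z(tau_A = oo), which
   are also the limits of those of H_A^m(y).

   The normalised functions G(., x) are positive and harmonic off x, so their
   limit points are positive harmonic functions on the lattice, and the ratio
   limit reduces to the strong Liouville property.  The latter follows from a
   Harnack inequality for global positive harmonic functions u: De Giorgi's
   iteration gives a mean value inequality for subharmonic functions; applied to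
   the positive part of a constant minus ln u, together with the Poincare
   inequality and the logarithmic Caccioppoli inequality, it shows that u is
   bounded below on a box as soon as it is on a positive fraction of it; a
   point-picking argument then excludes large values of u. *)

(** The weights are only bounded above and below, so there is no Fourier analysis and no explicit
    Green function; every analytic input is an energy inequality, which sees the weights only
    through these bounds. Sup-norm boxes are used because their translates and cardinalities are
    explicit: Poincare and Faber-Krahn both come from one estimate of f(x + v) - f(x). As the limit
    functions are harmonic on the whole lattice, boxes may be taken as large as wished around two
    given points, which spares a local Harnack inequality and a John-Nirenberg argument. The
    dimension also enters through the energy: averages over dyadic boxes have increments of order
    2^(k(2-d)/2), so a finite energy controls the values of the function, and this makes the Green
    function finite. For H_A^m no ratio limit is needed: P_z(exit from B(0,m) before the return to
    A) tends to P_z(tau_A = oo), since the walk leaves every finite set but moves by one step at a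
    time. The limiting denominator is positive because 1 - H, with H the return law on A, is the
    inverse of the Green matrix of A: the escape probabilities cannot all vanish. *)

Set Implicit Arguments.
Unset Strict Implicit.
Unset Printing Implicit Defensive.

(** * The lattice and its boxes *)

(* Matrix coefficients are generalised first, because [lia] does not recognise
   them as atoms. *)
Ltac coord_lia :=
  repeat match goal with
  | |- context [fun_of_matrix ?x ?i ?j] =>
      let a := fresh "a" in set a := fun_of_matrix x i j; clearbody a
  end; lia.

(* Locked, so that [big_map] and the like do not see through it. *)
HB.lock Definition box (d : nat) (c : 'rV[int]_d) (r : nat) : seq 'rV[int]_d :=
  [seq c + \row_i ((f i : nat)%:Z - r%:Z)
    | f : {ffun 'I_d -> 'I_(r.*2.+1)} <- enum {: {ffun 'I_d -> 'I_(r.*2.+1)}}].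

Section Lattice.
Context {d : nat}.
Local Notation V := 'rV[int]_d.
Implicit Types (x y z c v : V) (r : nat).

Definition supn x : nat := \max_(i < d) `|x 0%R i|%N.
Definition norm1n x : nat := (\sum_(i < d) `|x 0%R i|)%N.

Lemma norm1E x : norm1 x = (norm1n x)%:Z.
Proof.
rewrite /norm1 /norm1n (big_morph Posz PoszD (erefl _)).
by apply: eq_bigr => i _; rewrite abszE.
Qed.

Lemma nneighbourE x y : nneighbour x y = (norm1n (x - y) == 1%N).
Proof. by rewrite /nneighbour norm1E. Qed.

Lemma supnP x r : reflect (forall i, `|x 0%R i|%N <= r)%N (supn x <= r)%N.
Proof.
apply: (iffP (bigmax_leqP _ _ _)) => h i; first exact: h.
by move=> _; apply: h.
Qed.

Lemma le_supn x i : (`|x 0%R i| <= supn x)%N.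
Proof. exact: (supnP x (supn x) (leqnn _)). Qed.

Lemma supnN x : supn (- x) = supn x.
Proof. by apply: eq_bigr => i _; rewrite mxE abszN. Qed.

Lemma supnB x y : supn (x - y) = supn (y - x).
Proof. by rewrite -supnN opprB. Qed.

Lemma supnD x y : (supn (x + y) <= supn x + supn y)%N.
Proof.
apply/supnP => i; rewrite mxE; have := le_supn x i; have := le_supn y i.
by coord_lia.
Qed.

Lemma supn0 : supn 0 = 0%N.
Proof. by apply/eqP; rewrite -leqn0; apply/supnP => i; rewrite mxE. Qed.

Lemma norm1nN x : norm1n (- x) = norm1n x.
Proof. by apply: eq_bigr => i _; rewrite mxE abszN. Qed.

Lemma norm1nD x y : (norm1n (x + y) <= norm1n x + norm1n y)%N.
Proof.
rewrite /norm1n -big_split /=; by apply: leq_sum => i _; rewrite mxE; coord_lia.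
Qed.

Lemma norm1n0 : norm1n 0 = 0%N.
Proof. by rewrite /norm1n big1 // => i _; rewrite mxE. Qed.

Lemma norm1n_eq0 x : norm1n x = 0%N -> x = 0.
Proof.
move=> h; apply/rowP => i; rewrite mxE; apply/eqP; rewrite -absz_eq0.
by move/eqP: h; rewrite sum_nat_eq0 => /forallP/(_ i).
Qed.

Lemma supn_le_norm1n x : (supn x <= norm1n x)%N.
Proof. by apply/supnP => i; rewrite /norm1n (bigD1 i) //= leq_addr. Qed.

Lemma norm1n_le_supn x : (norm1n x <= d * supn x)%N.
Proof.
rewrite -[d in (d * _)%N]card_ord -sum_nat_const; apply: leq_sum => i _.
exact: le_supn.
Qed.

Lemma nneighbour_sym x y : nneighbour x y = nneighbour y x.
Proof. by rewrite !nneighbourE -norm1nN opprB. Qed.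

Lemma nneighbour_supn x y : nneighbour x y -> (supn (x - y) <= 1)%N.
Proof. by rewrite nneighbourE => /eqP h;
  rewrite (leq_trans (supn_le_norm1n _)) ?h. Qed.

(** The step [e] goes along a nonzero coordinate of [v], with its sign. Iterating builds lattice
    paths; the bound on [supn] keeps them in a box. *)
Lemma norm1n_step v n : norm1n v = n.+1 ->
  exists e, [/\ norm1n e = 1%N, norm1n (v - e) = n &
    (supn (v - e) <= supn v)%N].
Proof.
move=> hv.
have [i vi0] : exists i, v 0 i != 0.
  apply/existsP; apply: contra_eqT hv; rewrite negb_exists => /forallP h.
  by rewrite /norm1n big1 // => i _; move: (h i); rewrite negbK => /eqP ->.
pose e : V := \row_j (if j == i then Num.sg (v 0 i) else 0).
have eE j : e 0 j = (if j == i then Num.sg (v 0 i) else 0) by rewrite mxE.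
have hsg : (`|(v 0%R i - Num.sg (v 0%R i))%R| = `|v 0%R i| - 1)%N.
  move: (v 0 i) vi0 => z z0; case: sgrP z0 => //; lia.
have hle : (0 < `|v 0%R i|)%N by rewrite absz_gt0.
exists e; split.
- rewrite /norm1n (bigD1 i) //= eE eqxx big1 ?addn0.
    by move: vi0; case: sgrP.
  by move=> j ji; rewrite eE (negbTE ji).
- move: hv; rewrite /norm1n (bigD1 i) //= => hv.
  rewrite (bigD1 i) //= !mxE eqxx hsg.
  rewrite (eq_bigr (fun j => `|v 0%R j|%N)); first by move: hv hle; lia.
  by move=> j ji; rewrite !mxE (negbTE ji) subr0.
- apply/supnP => j; rewrite !mxE; case: eqVneq => [->|_].
    by rewrite hsg (leq_trans (leq_subr _ _)) ?le_supn.
  by rewrite subr0 le_supn.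
Qed.

Lemma mem_box c r y : (y \in box c r) = (supn (y - c) <= r)%N.
Proof.
rewrite box.unlock; apply/mapP/supnP => [[f _ ->] i|h].
  rewrite [c + _]addrC addrK mxE; by have := ltn_ord (f i);
    move: (nat_of_ord _) => k; lia.
have hh i : (absz (((y - c) 0 i + r%:Z))%R < r.*2.+1)%N by have := h i;
  coord_lia.
exists [ffun i => Ordinal (hh i)]; rewrite ?mem_enum //; apply/rowP => i.
rewrite !mxE ffunE /=; have := h i; rewrite !mxE; coord_lia.
Qed.

Lemma box_uniq c r : uniq (box c r).
Proof.
rewrite box.unlock map_inj_uniq ?enum_uniq // => f g /addrI /rowP h.
by apply/ffunP => i; apply/val_inj; have := h i; rewrite !mxE /=; lia.
Qed.

Lemma size_box c r : size (box c r) = ((r.*2.+1) ^ d)%N.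
Proof. by rewrite box.unlock size_map -cardE card_ffun !card_ord. Qed.

Lemma box_trans c r x y n :
  x \in box c r -> (supn (y - x) <= n)%N -> y \in box c (r + n).
Proof.
rewrite !mem_box => h1 h2; rewrite -(subrK x y) -addrA addrC.
by apply: leq_trans (supnD _ _) _; rewrite leq_add.
Qed.

Lemma box_nneighbour c r x y : x \in box c r -> nneighbour x y ->
  y \in box c r.+1.
Proof.
by move=> h1 h2; rewrite -[r.+1]addn1; apply: box_trans h1 _;
  rewrite supnB nneighbour_supn.
Qed.

Lemma box_sub c r r' : (r <= r')%N -> {subset box c r <= box c r'}.
Proof. by move=> h x; rewrite !mem_box => /leq_trans; apply. Qed.

Lemma box_center c r : c \in box c r.
Proof. by rewrite mem_box subrr supn0. Qed.

Lemma box_sym x y r : (x \in box y r) = (y \in box x r).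
Proof. by rewrite !mem_box supnB. Qed.

Definition nbrs x : seq V := [seq y <- box x 1 | nneighbour x y].

Lemma mem_nbrs x y : (y \in nbrs x) = nneighbour x y.
Proof.
rewrite mem_filter andb_idr // => /nneighbour_supn.
by rewrite mem_box supnB.
Qed.

Lemma nbrs_uniq x : uniq (nbrs x).
Proof. exact/filter_uniq/box_uniq. Qed.

Lemma size_nbrs x : (size (nbrs x) <= 3 ^ d)%N.
Proof. by rewrite size_filter (leq_trans (count_size _ _)) // size_box. Qed.

End Lattice.

(** * Finite sums over duplicate-free sequences *)

Section SeqSums.
Context {R : realType} {T : eqType}.
Implicit Types (s : seq T) (F G : T -> R).

Lemma sum_sub_uniq s1 s2 F : uniq s1 -> {subset s1 <= s2} ->
  (forall x, x \in s2 -> 0 <= F x) ->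
  \sum_(x <- s1) F x <= \sum_(x <- s2) F x.
Proof.
elim: s1 s2 => [|x s1 IH] s2 /=.
  by move=> _ _ h; rewrite big_nil big_seq sumr_ge0.
move=> /andP[xs1 u1] h F0; have xs2 : x \in s2 by apply: h; rewrite mem_head.
rewrite big_cons [leRHS](perm_big _ (perm_to_rem xs2)) big_cons lerD2l.
apply: IH => // z.
  move=> zs; have zx : z != x by apply: contraNneq xs1 => <-.
  have : z \in s2 by apply: h; rewrite inE zs orbT.
  by rewrite (perm_mem (perm_to_rem xs2)) inE (negbTE zx).
by move=> zr; apply: F0; apply: mem_rem zr.
Qed.

Lemma sum_ge_term s F x : x \in s -> (forall y, y \in s -> 0 <= F y) ->
  F x <= \sum_(y <- s) F y.
Proof.
move=> xs F0; have := @sum_sub_uniq [:: x] s F _ _ F0; rewrite big_seq1;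
  apply=> //.
by move=> z; rewrite inE => /eqP ->.
Qed.

Lemma ler_sum_seq s F G : (forall x, x \in s -> F x <= G x) ->
  \sum_(x <- s) F x <= \sum_(x <- s) G x.
Proof. by move=> h; rewrite !(big_seq _ _ s) ler_sum. Qed.

Lemma sumr_ge0_seq s F : (forall x, x \in s -> 0 <= F x) ->
  0 <= \sum_(x <- s) F x.
Proof. by move=> h; rewrite big_seq sumr_ge0. Qed.

Lemma sum_const_seq s (k : R) : \sum_(x <- s) k = (size s)%:R * k.
Proof. by rewrite big_const_seq count_predT iter_addr_0 mulr_natl. Qed.

Lemma eq_sum_support s1 s2 F : uniq s1 -> uniq s2 ->
  (forall x, F x != 0 -> (x \in s1) = (x \in s2)) ->
  \sum_(x <- s1) F x = \sum_(x <- s2) F x.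
Proof.
move=> u1 u2 h.
rewrite (bigID (fun x => F x != 0)) /= [X in _ + X]big1 ?addr0; last first.
  by move=> x; rewrite negbK => /eqP.
rewrite [RHS](bigID (fun x => F x != 0)) /= [X in _ = _ + X]big1 ?addr0;
  last first.
  by move=> x; rewrite negbK => /eqP.
rewrite -!(big_filter _ (fun x => F x != 0)); apply: perm_big.
apply: uniq_perm; rewrite ?filter_uniq // => x; rewrite !mem_filter.
by case: (boolP (F x != 0)) => // /h.
Qed.

End SeqSums.

(** * Poincare and Faber-Krahn inequalities *)

Section Translation.
Context {R : realType} {d : nat}.
Local Notation V := 'rV[int]_d.
Implicit Types (x y z c v : V) (r : nat) (f : V -> R).

Definition energy c r f : R :=
  \sum_(x <- box c r) \sum_(y <- box c r | nneighbour x y) (f x - f y) ^+ 2.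

Lemma energy_ge0 c r f : 0 <= energy c r f.
Proof. by apply: sumr_ge0 => x _; apply: sumr_ge0 => y _; apply: sqr_ge0. Qed.

(** Distinct [x] give distinct edges from [x + v] to [x + v + e], all inside the larger box, so the
    left side is part of the energy sum. *)
Lemma energy_shift c r N f v e : norm1n e = 1%N -> (supn v <= N)%N ->
  (supn (v + e) <= N)%N ->
  \sum_(x <- box c r) (f (x + (v + e)) - f (x + v)) ^+ 2
    <= energy c (r + N) f.
Proof.
move=> e1 hv hve; pose s := [seq x + v | x <- box c r].
have ss : {subset s <= box c (r + N)}.
  move=> _ /mapP[x xb ->]; apply: box_trans xb _.
  by rewrite [x + v]addrC addrK.
have -> : \sum_(x <- box c r) (f (x + (v + e)) - f (x + v)) ^+ 2 =
    \sum_(z <- s) (f (z + e) - f z) ^+ 2.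
  by rewrite /s big_map; apply: eq_bigr => x _; rewrite -addrA.
apply: (@le_trans _ _ (\sum_(x <- s)
    \sum_(y <- box c (r + N) | nneighbour x y) (f x - f y) ^+ 2)).
  apply: ler_sum_seq => z /mapP[x xb ->].
  rewrite -sqrrN opprB big_mkcond /=.
  have hin : x + v + e \in box c (r + N).
    by apply: box_trans xb _; rewrite -[x + v + e]addrA [x + _]addrC addrK.
  have hn : nneighbour (x + v) (x + v + e).
    by rewrite nneighbourE opprD addNKr norm1nN e1.
  have := @sum_ge_term R _ _ (fun y => if nneighbour (x + v) y then
    (f (x + v) - f y) ^+ 2 else 0) _ hin.
  rewrite hn; apply => y _; case: ifP => _ //; exact: sqr_ge0.
apply: sum_sub_uniq => //; first by rewrite map_inj_uniq ?box_uniq //;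
  apply: addIr.
by move=> x _; apply: sumr_ge0 => y _; apply: sqr_ge0.
Qed.

(** Cauchy-Schwarz along a path of [norm1n v] unit steps: each step costs at most one energy, whence
    the square of the length. *)
Lemma translation c r N f v : (supn v <= N)%N ->
  \sum_(x <- box c r) (f (x + v) - f x) ^+ 2
    <= (norm1n v)%:R ^+ 2 * energy c (r + N) f.
Proof.
move En : (norm1n v) => n; elim: n v En => [|n IH] v En hv.
  rewrite (norm1n_eq0 En) expr0n mul0r big1 // => x _.
  by rewrite addr0 subrr expr0n.
have [e [e1 ve le]] := norm1n_step En.
have := energy_shift c r f e1 (leq_trans le hv); rewrite subrK => /(_ hv) h1.
have := IH _ ve (leq_trans le hv).
set a := \sum_(x <- _) _ => h2.
case: n IH En ve h2 => [|n] _ En ve.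
  move: h1; rewrite (norm1n_eq0 ve) => h1 _.
  rewrite expr1n mul1r; apply: le_trans h1.
  by under [leRHS]eq_bigr do rewrite addr0.
move: h1; set b := \sum_(x <- _) _ => h1 h2.
(* With k the length of [v - e], the weights (k + 1) / k and k + 1 are those that turn the bounds
   k^2 E and E into (k + 1)^2 E. *)
have h3 : \sum_(x <- box c r) (f (x + v) - f x) ^+ 2 <=
   (n.+2%:R / n.+1%:R) * a + n.+2%:R * b.
  rewrite !mulr_sumr -big_split /=; apply: ler_sum => x _.
  move: (f (x + v)) (f (x + (v - e))) (f x) => A B C.
  rewrite -[n.+2]addn1 natrD.
  have : 0 < n.+1%:R :> R by rewrite ltr0n.
  move: (n.+1%:R : R) => k k0.
  rewrite -subr_ge0.
  have -> : (k + 1) / k * (B - C) ^+ 2 + (k + 1) * (A - B) ^+ 2 - (A - C) ^+ 2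
    = (B - C - k * (A - B)) ^+ 2 / k.
    by field; rewrite gt_eqF.
  by rewrite divr_ge0 ?sqr_ge0 // ltW.
apply: (le_trans h3).
have k0 : 0 < n.+1%:R :> R by rewrite ltr0n.
have -> : n.+2%:R = n.+1%:R + 1 :> R by rewrite -[n.+2]addn1 natrD.
move: k0 h2; move: (n.+1%:R : R) (energy _ _ _) h1 => k E h1 k0 h2.
apply: (@le_trans _ _ ((k + 1) / k * (k ^+ 2 * E) + (k + 1) * E)).
  apply: lerD; last by rewrite ler_wpM2l // addr_ge0 // ltW.
  by rewrite ler_wpM2l // divr_ge0 ?addr_ge0 // ltW.
by rewrite le_eqVlt; apply/orP; left; apply/eqP; field; rewrite gt_eqF.
Qed.

Lemma translation_box c r N f v : (supn v <= N)%N ->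
  \sum_(x <- box c r) (f (x + v) - f x) ^+ 2
    <= (d%:R * N%:R) ^+ 2 * energy c (r + N) f.
Proof.
move=> hv; apply: le_trans (translation c r f hv) _.
rewrite ler_wpM2r ?energy_ge0 //.
rewrite -natrM -!natrX ler_nat leq_sqr.
by rewrite (leq_trans (norm1n_le_supn _)) // leq_mul2l hv orbT.
Qed.

(** Sort the pairs by their difference [v = y - x], which lies in the box of radius [r + r'], and
    apply [translation_box] to each [v]. *)
Lemma poincare c r r' f :
  \sum_(x <- box c r) \sum_(y <- box c r') (f x - f y) ^+ 2 <=
  ((r + r').*2.+1 ^ d)%:R * (d%:R * (r + r')%:R) ^+ 2
    * energy c (r + (r + r')) f.
Proof.
apply: (@le_trans _ _ (\sum_(v <- box 0 (r + r'))
     \sum_(x <- box c r) (f (x + v) - f x) ^+ 2)); last first.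
  rewrite -(size_box (0 : V)) -mulrA -sum_const_seq; apply: ler_sum_seq => v.
  by rewrite mem_box subr0 => hv; apply: translation_box.
rewrite [leRHS]exchange_big /=; apply: ler_sum_seq => x xb.
rewrite -(big_map (fun v => x + v) xpredT (fun y => (f y - f x) ^+ 2)).
under eq_bigr do rewrite -sqrrN opprB.
apply: sum_sub_uniq => [|y yb|y _]; [exact: box_uniq| |exact: sqr_ge0].
apply/mapP; exists (y - x); last by rewrite addrC subrK.
move: xb yb; rewrite !mem_box subr0 => h1 h2.
have -> : y - x = (y - c) + (c - x) by rewrite addrA subrK.
by rewrite (leq_trans (supnD _ _)) // addnC leq_add // supnB.
Qed.

(* For [x] in the support, at least half of the translates [x + v] leave it,
   and each of those contributes [f x ^+ 2]. *)
Lemma faber_krahn c r L f (Omega : seq V) :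
  (forall x, x \notin Omega -> f x = 0) ->
  (2 * size Omega <= L.*2.+1 ^ d)%N ->
  \sum_(x <- box c r) f x ^+ 2 <=
    2 * (d%:R * L%:R) ^+ 2 * energy c (r + L) f.
Proof.
move=> hO hL.
have n0 : 0 < (L.*2.+1 ^ d)%:R :> R by rewrite ltr0n expn_gt0.
suff h : (L.*2.+1 ^ d)%:R * \sum_(x <- box c r) f x ^+ 2 <=
  2 * \sum_(v <- box 0 L) \sum_(x <- box c r) (f (x + v) - f x) ^+ 2.
  rewrite -(ler_pM2l n0); apply: (le_trans h).
  apply: (@le_trans _ _ (2 * \sum_(v <- box (0 : V) L)
     ((d%:R * L%:R) ^+ 2 * energy c (r + L) f))).
    rewrite ler_wpM2l //; apply: ler_sum_seq => v.
    by rewrite mem_box subr0 => hv; apply: translation_box.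
  by rewrite sum_const_seq size_box; lra.
rewrite [in leRHS]exchange_big /= !mulr_sumr; apply: ler_sum_seq => x xb.
apply: (@le_trans _ _ (2 * \sum_(v <- box 0 L | x + v \notin Omega)
   (f (x + v) - f x) ^+ 2)); last first.
  rewrite ler_wpM2l // big_mkcond /=; apply: ler_sum => v _.
  by case: ifP => // _; apply: sqr_ge0.
rewrite (eq_bigr (fun=> f x ^+ 2)); last first.
  by move=> v h; rewrite hO // sub0r sqrrN.
rewrite big_const_seq iter_addr_0 -[f x ^+ 2 *+ _]mulr_natl mulrA -natrM.
rewrite ler_wpM2r ?sqr_ge0 // ler_nat.
set k := count _ _.
have hk : (L.*2.+1 ^ d <= k + size Omega)%N.
  rewrite -(size_box (0 : V)) -(count_predC (fun v =>
    x + v \notin Omega)) leq_add2l.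
  rewrite -size_filter -(size_map (fun v => x + v)); apply: uniq_leq_size.
    by rewrite map_inj_uniq ?filter_uniq ?box_uniq //; apply: addrI.
  by move=> _ /mapP[v + ->]; rewrite mem_filter /= negbK => /andP[].
lia.
Qed.

End Translation.

(** * Subharmonic functions: Caccioppoli and mean value inequalities *)

Record elliptic_weights (R : realType) (d : nat) (ce : R)
    (a : 'rV[int]_d -> 'rV[int]_d -> R) : Prop := EllipticWeights {
  ell_sym : forall x y, a x y = a y x;
  ell_nn : forall x y, ~~ nneighbour x y -> a x y = 0;
  ell_ge1 : 1 <= ce;
  ell_lb : forall x y, nneighbour x y -> ce^-1 <= a x y;
  ell_ub : forall x y, nneighbour x y -> a x y <= ce }.

Section Cutoff.
Context {R : realType} {d : nat}.
Local Notation V := 'rV[int]_d.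
Implicit Types (x y c : V).

(** The slope is 1 / n between the radii [rho] and [rho + n]; the truncated subtraction of natural
    numbers makes the function vanish beyond. *)
Definition cutoff c (rho n : nat) x : R :=
  (minn n (rho + n - supn (x - c)))%:R / n%:R.

Lemma cutoff_in c rho n x : (0 < n)%N -> x \in box c rho ->
  cutoff c rho n x = 1.
Proof.
rewrite mem_box => n0 h; rewrite /cutoff (minn_idPl _) ?divff ?pnatr_eq0 //;
  lia.
Qed.

Lemma cutoff_supp c rho n x : cutoff c rho n x != 0 ->
  (supn (x - c) < rho + n)%N.
Proof.
apply: contra_neqT => h; rewrite /cutoff (_ : minn _ _ = 0%N) ?mul0r //; lia.
Qed.

Lemma cutoff_lip c rho n x y : (0 < n)%N -> nneighbour x y ->
  (cutoff c rho n x - cutoff c rho n y) ^+ 2 <= (n%:R ^+ 2)^-1.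
Proof.
move=> n0 hn; rewrite /cutoff -mulrBl exprMn exprVn -[leRHS]mul1r.
rewrite ler_wpM2r ?invr_ge0 ?sqr_ge0 //.
have h1 : (supn (x - c) <= supn (y - c) + 1)%N.
  rewrite -[x - c](subrK (y - c)) (leq_trans (supnD _ _)) // addnC leq_add2l.
  by rewrite opprB addrA subrK nneighbour_supn.
have h2 : (supn (y - c) <= supn (x - c) + 1)%N.
  rewrite -[y - c](subrK (x - c)) (leq_trans (supnD _ _)) // addnC leq_add2l.
  by rewrite opprB addrA subrK nneighbour_supn // nneighbour_sym.
set p := minn _ _; set q := minn _ _.
have h3 : (p <= q + 1)%N by rewrite /p /q; lia.
have h4 : (q <= p + 1)%N by rewrite /p /q; lia.
move: h3 h4; rewrite -!(ler_nat R) !natrD => h3 h4; nra.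
Qed.

End Cutoff.

Section Weights.
Context {R : realType} {d : nat} {a : 'rV[int]_d -> 'rV[int]_d -> R} {ce : R}.
Context (Ha : elliptic_weights ce a).
Local Notation V := 'rV[int]_d.
Implicit Types (x y z c : V) (r : nat) (w u f g : V -> R) (S : seq V).

Lemma ce_gt0 : 0 < ce.
Proof. exact: lt_le_trans (ell_ge1 Ha). Qed.

Lemma weight_ge0 x y : 0 <= a x y.
Proof.
have [h|h] := boolP (nneighbour x y); last by rewrite (ell_nn Ha).
by apply: le_trans (ell_lb Ha h); rewrite invr_ge0 (ltW ce_gt0).
Qed.

Lemma sum_weight_sub S x g : uniq S -> {subset nbrs x <= S} ->
  \sum_(y <- S) a x y * g y = \sum_(y <- nbrs x) a x y * g y.
Proof.
move=> uS h; apply: eq_sum_support (nbrs_uniq x) _ => // y.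
have [hn _|hn] := boolP (nneighbour x y).
  by rewrite mem_nbrs hn h // mem_nbrs.
by rewrite (ell_nn Ha hn) mul0r eqxx.
Qed.

(** Positive sign convention: this is [vweight a x] times the identity minus the averaging operator,
    so subharmonic means [lap <= 0]. *)
Definition lap w x : R := \sum_(y <- nbrs x) a x y * (w x - w y).

Definition subharmonic w := forall x, lap w x <= 0.

Definition harmonic w := forall x, lap w x = 0.

Lemma subharmonic_pos w k : subharmonic w ->
  subharmonic (fun x => Num.max (w x - k) 0).
Proof.
move=> h x; have [wk|wk] := leP (w x - k) 0.
  rewrite /lap big_seq; apply: sumr_le0 => y _.
  by rewrite mulr_ge0_le0 ?weight_ge0 // max_r //
    sub0r oppr_le0 le_max lexx orbT.
apply: le_trans (h x); apply: ler_sum => y _.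
rewrite ler_wpM2l ?weight_ge0 // (max_l (ltW wk)).
have : w y - k <= Num.max (w y - k) 0 by rewrite le_max lexx.
lra.
Qed.

(** Discrete Green formula, without boundary term because the inner sums stop at [S]. They are
    values of [lap] only at points whose neighbours all lie in [S], so [g] is later taken to vanish
    at points where this may fail. *)
Lemma dirichlet_parts S g w :
  \sum_(x <- S) \sum_(y <- S) a x y * ((g x - g y) * (w x - w y)) =
  2 * \sum_(x <- S) g x * \sum_(y <- S) a x y * (w x - w y).
Proof.
transitivity (\sum_(x <- S) \sum_(y <- S) a x y * (g x * (w x - w y)) +
              \sum_(x <- S) \sum_(y <- S) a x y * (g y * (w y - w x))).
  rewrite -big_split; apply: eq_bigr => x _; rewrite -big_split /=.
  by apply: eq_bigr => y _; ring.
rewrite [X in _ + X]exchange_big /= mulr2n mulrDl !mul1r.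
congr (_ + _); apply: eq_bigr => x _; rewrite mulr_sumr.
  by apply: eq_bigr => y _; ring.
by apply: eq_bigr => y _; rewrite (ell_sym Ha y x); ring.
Qed.

(* Ground state identity: (w - v)(p^2 w - q^2 v) = (p w - q v)^2 - w v (p - q)^2. *)
Lemma caccioppoli_sum S w (phi : V -> R) : uniq S ->
  (forall x, phi x != 0 -> {subset nbrs x <= S}) ->
  (forall x, 0 <= w x) -> subharmonic w ->
  \sum_(x <- S) \sum_(y <- S) a x y * (phi x * w x - phi y * w y) ^+ 2 <=
  \sum_(x <- S) \sum_(y <- S) a x y * (w x * w y * (phi x - phi y) ^+ 2).
Proof.
move=> uS hS w0 hw; rewrite -subr_le0 -sumrB.
under eq_bigr do rewrite -sumrB.
rewrite (eq_bigr (fun x => \sum_(y <- S)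
  a x y * ((phi x ^+ 2 * w x - phi y ^+ 2 * w y) * (w x - w y)))); last first.
  by move=> x _; apply: eq_bigr => y _; ring.
rewrite (dirichlet_parts S (fun x => phi x ^+ 2 * w x)) pmulr_rle0 //.
rewrite big_seq; apply: sumr_le0 => x _.
have [->|px] := eqVneq (phi x) 0; first by rewrite expr0n !mul0r.
rewrite (sum_weight_sub _ uS (hS _ px)) mulr_ge0_le0 //.
  by rewrite mulr_ge0 ?sqr_ge0.
exact: hw.
Qed.

Lemma energy_le_weight c M f :
  energy c M f <=
  ce * \sum_(x <- box c M) \sum_(y <- box c M) a x y * (f x - f y) ^+ 2.
Proof.
rewrite mulr_sumr; apply: ler_sum => x _; rewrite mulr_sumr big_mkcond /=.
apply: ler_sum => y _; case: ifP => hn; last first.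
  by rewrite (mulr_ge0 (ltW ce_gt0)) ?(mulr_ge0 (weight_ge0 _ _)) ?sqr_ge0.
rewrite mulrA -[leLHS]mul1r ler_wpM2r ?sqr_ge0 //.
by rewrite -(divff (lt0r_neq0 ce_gt0)) ler_pM2l ?ce_gt0 // (ell_lb Ha).
Qed.

Lemma cutoff_gradient c M rho n x : (0 < n)%N ->
  \sum_(y <- box c M) a x y * (cutoff c rho n x - cutoff c rho n y : R) ^+ 2 <=
  if x \in box c (rho + n) then ce * (3 ^ d)%:R / n%:R ^+ 2 else 0.
Proof.
move=> n0; case: ifPn => hx; last first.
  rewrite big1 // => y _.
  have [hn|hn] := boolP (nneighbour x y); last by rewrite (ell_nn Ha hn) mul0r.
  have zx : cutoff c rho n x = 0 :> R.
    apply/eqP; apply: contraNT hx => /cutoff_supp h; rewrite mem_box ltnW //.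
  have zy : cutoff c rho n y = 0 :> R.
    apply/eqP; apply: contraNT hx => /cutoff_supp h; rewrite mem_box.
    rewrite -[x - c](subrK (y - c)) (leq_trans (supnD _ _)) //.
    rewrite opprB addrA subrK; apply: leq_trans h.
    by have := nneighbour_supn hn; rewrite -(leq_add2r (supn (y - c))).
  by rewrite zx zy subrr expr0n mulr0.
rewrite (bigID (fun y => nneighbour x y)) /= [X in _ + X]big1 ?addr0;
  last first.
  by move=> y h; rewrite (ell_nn Ha) ?mul0r.
rewrite -big_filter.
apply: (@le_trans _ _ (\sum_(y <- [seq y <- box c M | nneighbour x y])
   (ce / n%:R ^+ 2))).
  apply: ler_sum_seq => y; rewrite mem_filter => /andP[hn _].
  apply: ler_pM; rewrite ?weight_ge0 ?sqr_ge0 ?(ell_ub Ha) //.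
  exact: cutoff_lip.
rewrite sum_const_seq mulrCA -mulrA ler_wpM2l ?(ltW ce_gt0) //.
rewrite ler_wpM2r ?invr_ge0 ?sqr_ge0 // ler_nat.
apply: leq_trans (size_nbrs x); apply: uniq_leq_size.
  exact/filter_uniq/box_uniq.
by move=> y; rewrite mem_filter mem_nbrs => /andP[].
Qed.

Lemma cutoff_interior c M rho n x : (rho + n <= M)%N ->
  cutoff c rho n x != 0 :> R -> {subset nbrs x <= box c M}.
Proof.
move=> hM /cutoff_supp h y; rewrite mem_nbrs => hn; apply: (box_sub hM).
have hx : x \in box c (rho + n).-1 by rewrite mem_box; lia.
have := box_nneighbour hx hn; rewrite prednK //; lia.
Qed.

Lemma caccioppoli c M rho n w : (0 < n)%N -> (rho + n <= M)%N ->
  (forall x, 0 <= w x) -> subharmonic w ->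
  energy c M (fun x => cutoff c rho n x * w x) <=
  ce ^+ 2 * (3 ^ d)%:R / n%:R ^+ 2 * \sum_(x <- box c (rho + n)) w x ^+ 2.
Proof.
move=> n0 hM w0 hw; apply: le_trans (energy_le_weight _ _ _) _.
rewrite expr2 -!mulrA ler_pM2l ?ce_gt0 // !mulrA.
apply: le_trans (caccioppoli_sum (box_uniq c M) _ w0 hw) _.
  by move=> x; apply: cutoff_interior.
pose phi x : R := cutoff c rho n x.
(* The product [w x * w y] is at most half the sum of the squares, and both halves agree by symmetry
   of [a]. *)
apply: (@le_trans _ _ (2^-1 * (\sum_(x <- box c M) \sum_(y <- box c M)
     a x y * (w x ^+ 2 * (phi x - phi y) ^+ 2) +
   \sum_(x <- box c M) \sum_(y <- box c M)
     a x y * (w y ^+ 2 * (phi y - phi x) ^+ 2)))).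
  rewrite -big_split mulr_sumr; apply: ler_sum => x _.
  rewrite -big_split mulr_sumr; apply: ler_sum => y _ /=.
  rewrite -mulrDr [leRHS]mulrCA ler_wpM2l ?weight_ge0 //.
  rewrite -(sqrrN (phi y - phi x)) opprB -mulrDl [leRHS]mulrA.
  rewrite ler_wpM2r ?sqr_ge0 //.
  by have := sqr_ge0 (w x - w y); nra.
rewrite [X in _ + X]exchange_big /=.
under [X in _ + X]eq_bigr do under eq_bigr do rewrite (ell_sym Ha).
rewrite -mulr2n -[X in _ * X]mulr_natl mulKf ?pnatr_eq0 //.
apply: (@le_trans _ _ (\sum_(x <- box c M | x \in box c (rho + n))
  w x ^+ 2 * (ce * (3 ^ d)%:R / n%:R ^+ 2))).
  rewrite [leRHS]big_mkcond /=; apply: ler_sum => x _.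
  under eq_bigr do rewrite mulrCA; rewrite -mulr_sumr.
  have := @cutoff_gradient c M rho n x n0.
  case: ifP => _ h; last first.
    by rewrite mulr_ge0_le0 ?sqr_ge0.
  by rewrite ler_wpM2l ?sqr_ge0.
rewrite -mulr_suml mulrC ler_wpM2l //.
  by rewrite divr_ge0 ?sqr_ge0 // mulr_ge0 ?(ltW ce_gt0).
rewrite -[leLHS]big_filter; apply: sum_sub_uniq => [|x|x _].
- by rewrite filter_uniq ?box_uniq.
- by rewrite mem_filter => /andP[].
- exact: sqr_ge0.
Qed.

End Weights.
Arguments lap {R d} a w x.
Arguments subharmonic {R d} a w.
Arguments harmonic {R d} a w.

(** * De Giorgi iteration *)

Section MeanValue.
Context {R : realType} {d : nat} {a : 'rV[int]_d -> 'rV[int]_d -> R} {ce : R}.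
Context (Ha : elliptic_weights ce a).
Local Notation V := 'rV[int]_d.
Implicit Types (x y z c : V) (w : V -> R).

Definition pospart w (k : R) x : R := Num.max (w x - k) 0.

Lemma pospart_ge0 w k x : 0 <= pospart w k x.
Proof. by rewrite le_max lexx orbT. Qed.

(** By Chebyshev, the hypothesis says that [w > k] on at most half as many points as a box of radius
    [L] has. Faber-Krahn then applies to the cut-off function [pospart w k], and Caccioppoli bounds
    its energy. *)
Lemma de_giorgi_step c rho n L w (h k : R) :
  (0 < n)%N -> h < k -> subharmonic a w ->
  2 * \sum_(x <- box c (rho + n)) pospart w h x ^+ 2 <=
    (L.*2.+1 ^ d)%:R * (k - h) ^+ 2 ->
  \sum_(x <- box c rho) pospart w k x ^+ 2 <=
  2 * (d%:R * L%:R) ^+ 2 * (ce ^+ 2 * (3 ^ d)%:R / n%:R ^+ 2) *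
    \sum_(x <- box c (rho + n)) pospart w h x ^+ 2.
Proof.
move=> n0 hk hw hA.
pose Omega := [seq x <- box c (rho + n) | k < w x].
pose f x := cutoff c rho n x * pospart w k x : R.
have f_supp x : x \notin Omega -> f x = 0.
  rewrite mem_filter negb_and -leNgt => /orP[wk|xb].
    by rewrite /f /pospart max_r ?mulr0 // subr_le0.
  rewrite /f (_ : cutoff _ _ _ _ = 0) ?mul0r //; apply/eqP.
  by apply: contraNT xb => /cutoff_supp hx; rewrite mem_box ltnW.
have ph x : pospart w k x ^+ 2 <= pospart w h x ^+ 2.
  rewrite ler_sqr ?nnegrE ?pospart_ge0 //
    /pospart ge_max !le_max lexx orbT andbT.
  by rewrite lerD2l lerN2 (ltW hk).
have sO : (2 * size Omega <= L.*2.+1 ^ d)%N.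
  have kh : 0 < (k - h) ^+ 2 by rewrite exprn_gt0 // subr_gt0.
  rewrite -(ler_nat R) natrM -(ler_pM2r kh); apply: le_trans hA.
  rewrite -mulrA ler_pM2l // -sum_const_seq.
  apply: (@le_trans _ _ (\sum_(x <- Omega) pospart w h x ^+ 2)).
    apply: ler_sum_seq => x; rewrite mem_filter => /andP[wk _].
    rewrite ler_sqr ?nnegrE ?pospart_ge0 ?subr_ge0 ?(ltW hk) //.
    by rewrite le_max lerD2r (ltW wk).
  apply: sum_sub_uniq => [|x|x _]; last exact: sqr_ge0.
    by rewrite filter_uniq ?box_uniq.
  by rewrite mem_filter => /andP[].
have h1 : \sum_(x <- box c rho) pospart w k x ^+ 2 <=
    \sum_(x <- box c (rho + n)) f x ^+ 2.
  apply: (@le_trans _ _ (\sum_(x <- box c rho) f x ^+ 2)).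
    by apply: ler_sum_seq => x xb; rewrite /f cutoff_in // mul1r.
  apply: sum_sub_uniq => [|x|x _]; last exact: sqr_ge0.
    exact: box_uniq.
  by apply: box_sub; rewrite leq_addr.
apply: (le_trans h1); apply: le_trans (faber_krahn c (rho + n) f_supp sO) _.
rewrite -[leRHS]mulrA ler_wpM2l ?mulr_ge0 ?sqr_ge0 //.
apply: le_trans (caccioppoli Ha c n0 (leq_addr L (rho + n))
  (pospart_ge0 w k) (subharmonic_pos Ha _ hw)) _.
by rewrite ler_wpM2l ?ler_sum // divr_ge0 ?sqr_ge0 // mulr_ge0 ?sqr_ge0.
Qed.

Lemma leq_expn2r m n e : (m <= n -> m ^ e <= n ^ e)%N.
Proof. by case: e => [|e] h; rewrite ?expn0 ?leq_exp2r. Qed.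

Lemma exp2_unbounded (C : R) : exists q : nat, C <= (2 ^ q)%:R.
Proof.
exists (Num.bound `|C|); apply: (@le_trans _ _ (Num.bound `|C|)%:R).
  exact: le_trans (ler_norm C) (ltW (archi_boundP (normr_ge0 C))).
by rewrite ler_nat ltnW // ltn_expl.
Qed.

(* De Giorgi iteration with radii [2 ^ J + 2 ^ (J - j)] and levels
   [K * (1 - 2 ^- j)].  Faber-Krahn is used at scale [2 ^ (J' - j)], which makes
   the energy excess decay like [2 ^- ((d + 2) * j)]; the iteration stops when
   that scale is 1, where the sum of squares already bounds each value. *)
Lemma mean_value : exists2 eps : R, 0 < eps & forall (J : nat) c w (K : R),
  0 < K -> (forall x, 0 <= w x) -> subharmonic a w ->
  \sum_(x <- box c (2 ^ J.+1)) w x ^+ 2 <= eps * K ^+ 2 * ((2 ^ J) ^ d)%:R ->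
  forall x, x \in box c (2 ^ J) -> w x <= 2 * K.
Proof.
pose C0 : R := 2 * d%:R ^+ 2 * (ce ^+ 2 * (3 ^ d)%:R).
have C0_ge0 : 0 <= C0.
  by rewrite (mulr_ge0 (mulr_ge0 _ (sqr_ge0 _)) (mulr_ge0 (sqr_ge0 _) _)).
(* [2 ^ q0] beats the constant [C0] times the gain [4 * 2 ^ d] wanted at each step; [q] is one
   larger because Faber-Krahn is used with the radius [2 * L]. *)
have [q0 hq0] := exp2_unbounded (C0 * (2 ^ d)%:R * 4).
pose q := q0.+1.
exists (8 * ((2 ^ q) ^ d)%:R)^-1.
  by rewrite invr_gt0 mulr_gt0 // ltr0n !expn_gt0.
move=> J c w K K0 w0 hw hA x xb.
have Q0 : 0 < ((2 ^ q) ^ d)%:R :> R by rewrite ltr0n !expn_gt0.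
have [Jq|qJ] := ltnP J q.
  have h1 : w x ^+ 2 <= K ^+ 2.
    apply: (@le_trans _ _ (\sum_(x <- box c (2 ^ J.+1)) w x ^+ 2)).
      apply: (@sum_ge_term R _ _ (fun x => w x ^+ 2)) => [|y _];
        last exact: sqr_ge0.
      by apply: box_sub xb; rewrite leq_exp2l.
    apply: (le_trans hA); rewrite mulrAC -[leRHS]mul1r ler_wpM2r ?sqr_ge0 //.
    rewrite mulrC ler_pdivrMr ?mulr_gt0 // mul1r -natrM ler_nat.
    apply: (@leq_trans ((2 ^ q) ^ d)%N); last by rewrite leq_pmull.
    by apply: leq_expn2r; rewrite leq_exp2l // ltnW.
  have := w0 x; move: h1; rewrite ler_sqr ?nnegrE ?w0 ?(ltW K0) //.
  by have := K0; lra.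
pose J' := (J - q)%N.
pose A j := \sum_(x <- box c (2 ^ J + 2 ^ (J - j)))
   pospart w (K * (1 - (2 ^ j)%:R^-1)) x ^+ 2.
(* This is exactly the hypothesis of [de_giorgi_step] at level [j]: 8 is the 2 found there times the
   4 of (k - h)^2 = K^2 / (4 * 4^j). *)
have inv j : (j <= J')%N ->
    8 * A j * (2 ^ j)%:R ^+ 2 <= K ^+ 2 * ((2 ^ (J' - j)) ^ d)%:R.
  elim: j => [_|j IH jJ].
    rewrite expn0 expr1n mulr1 subn0 /A subn0 addnn -mul2n -expnS.
    rewrite (eq_bigr (fun x => w x ^+ 2)); last first.
      by move=> y _; rewrite /pospart invr1 subrr mulr0 subr0 max_l.
    rewrite mulrC -ler_pdivlMr //; apply: (le_trans hA).
    rewrite (_ : (2 ^ J = 2 ^ q * 2 ^ J')%N); last first.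
      by rewrite -expnD subnKC.
    rewrite expnMn natrM le_eqVlt; apply/orP; left; apply/eqP; field.
    by rewrite gt_eqF.
  have {}IH := IH (ltnW jJ).
  pose L := (2 ^ (J' - j.+1))%N; pose n := (2 ^ (J - j.+1))%N.
  have X0 : 0 < (2 ^ j)%:R :> R by rewrite ltr0n expn_gt0.
  have L2 : (2 ^ (J' - j) = 2 * L)%N by rewrite -expnS -subSn.
  have n2 : (2 ^ (J - j) = n + n)%N.
    by rewrite addnn -mul2n -expnS -subSn //; move: jJ; rewrite /J'; lia.
  have nL : n = (2 ^ q * L)%N.
    by rewrite -expnD; congr (2 ^ _)%N; move: jJ; rewrite /J'; lia.
  have L0 : (0 < L)%N by rewrite expn_gt0.
  have n0 : (0 < n)%N by rewrite expn_gt0.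
  have := @de_giorgi_step c (2 ^ J + n) n L.*2 w (K * (1 - (2 ^ j)%:R^-1))
    (K * (1 - (2 ^ j.+1)%:R^-1)) n0 _ hw.
  rewrite -addnA -n2 -/(A j) -/(A j.+1) /n => step.
  have X2 : (2 ^ j.+1)%:R = 2 * (2 ^ j)%:R :> R by rewrite expnS natrM.
  have hkE : K * (1 - (2 ^ j.+1)%:R^-1) - K * (1 - (2 ^ j)%:R^-1) =
      K / (2 * (2 ^ j)%:R).
    by rewrite X2; field; rewrite gt_eqF.
  have A0 : 0 <= A j by apply: sumr_ge0 => y _; apply: sqr_ge0.
  (* The Faber-Krahn radius [2 * L] is smaller than the cutoff width [n] by the factor [2 ^ q0]. *)
  have factor :
      2 * (d%:R * L.*2%:R) ^+ 2 * (ce ^+ 2 * (3 ^ d)%:R / n%:R ^+ 2) <=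
      (4 * (2 ^ d)%:R)^-1.
    have L0' : 0 < L%:R :> R by rewrite ltr0n.
    have q00 : 1 <= (2 ^ q0)%:R :> R by rewrite ler1n expn_gt0.
    rewrite nL /q expnS -mul2n !natrM.
    rewrite -[leRHS]mul1r ler_pdivlMr ?mulr_gt0 ?ltr0n ?expn_gt0 //.
    move: hq0 q00 L0'; rewrite /C0.
    move: (L%:R : R) ((2 ^ q0)%:R : R) ((2 ^ d)%:R : R) ((3 ^ d)%:R : R) (d%:R
      : R).
    move=> l Q x2 x3 x1 h1 h2 l0.
    have -> : 2 * (x1 * (2 * l)) ^+ 2 * (ce ^+ 2 * x3 / (2 * Q * l) ^+ 2) * (4
      * x2)
       = 2 * x1 ^+ 2 * (ce ^+ 2 * x3) * x2 * 4 / Q ^+ 2.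
      by field; rewrite !gt_eqF // (lt_le_trans _ h2).
    rewrite ler_pdivrMr ?exprn_gt0 ?(lt_le_trans _ h2) // mul1r.
    by apply: le_trans h1 _; rewrite expr2 ler_peMr // (le_trans _ h2).
  have {step} := step _ _.
  rewrite hkE -subr_gt0 hkE => step.
  have {}step : A j.+1 <= A j / (4 * (2 ^ d)%:R).
    apply: le_trans (step _ _) _.
    - by rewrite divr_gt0 // mulr_gt0.
    - apply: (@le_trans _ _ (((2 * L) ^ d)%:R * (K / (2 * (2 ^ j)%:R)) ^+ 2)).
        rewrite expr_div_n mulrA ler_pdivlMr ?exprn_gt0 ?mulr_gt0 //.
        by move: IH; rewrite L2; lra.
      rewrite ler_wpM2r ?sqr_ge0 // ler_nat leq_expn2r //.
      by rewrite mul2n -[L.*2.*2]addnn -addnS leq_addr.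
    rewrite mulrC; rewrite (@ler_wpM2l _ (A j)) //.
  have {}step : A j.+1 * (4 * (2 ^ d)%:R) <= A j.
    have p4 : 0 < 4 * (2 ^ d)%:R :> R by rewrite mulr_gt0 ?ltr0n ?expn_gt0.
    by rewrite -(ler_pdivlMr _ _ p4).
  rewrite -/L X2; move: IH; rewrite L2 expnMn natrM => IH.
  have d0 : 0 < (2 ^ d)%:R :> R by rewrite ltr0n expn_gt0.
  rewrite -(ler_pM2r d0) mulrAC [leRHS]mulrAC -[leRHS]mulrA; apply: le_trans IH.
  rewrite exprMn.
  have -> : 8 * A j.+1 * (2 ^ d)%:R * (2 ^+ 2 * (2 ^ j)%:R ^+ 2) =
     8 * (A j.+1 * (4 * (2 ^ d)%:R)) * (2 ^ j)%:R ^+ 2 by ring.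
  by rewrite ler_wpM2r ?sqr_ge0 // ler_wpM2l.
have := inv J' (leqnn _); rewrite subnn expn0 exp1n mulr1 => hJ.
have A0 : 0 <= A J' by apply: sumr_ge0 => y _; apply: sqr_ge0.
have h1 : pospart w (K * (1 - (2 ^ J')%:R^-1)) x ^+ 2 <= K ^+ 2.
  apply: (@le_trans _ _ (A J')).
    apply: (@sum_ge_term R _ _ (fun x => pospart w _ x ^+ 2)) => [|y _].
      by apply: box_sub xb; rewrite leq_addr.
    exact: sqr_ge0.
  have : 1 <= (2 ^ J')%:R :> R by rewrite ler1n expn_gt0.
  move: hJ A0; move: (A J') ((2 ^ J')%:R : R) => B X hJ B0 X1.
  apply: le_trans hJ; rewrite mulrAC ler_peMl //.
  by have := exprn_ege1 2 X1; lra.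
move: h1; rewrite ler_sqr ?nnegrE ?pospart_ge0 ?(ltW K0) // ge_max =>
  /andP[h1 _].
have : 0 <= K / (2 ^ J')%:R by rewrite divr_ge0 // ltW.
by move: h1; rewrite mulrBr mulr1; lra.
Qed.

End MeanValue.

(** * Harnack inequality and Liouville theorem *)

Section LogEstimate.
Context {R : realType} {d : nat} {a : 'rV[int]_d -> 'rV[int]_d -> R} {ce : R}.
Context (Ha : elliptic_weights ce a).
Local Notation V := 'rV[int]_d.
Implicit Types (x y z c : V) (w u : V -> R).

(** If |ln s - ln t| = 2h, the bracket is (e^h - e^-h)^2, and e^h - e^-h >= h follows from e^h >= 1
    + h and e^-h <= 1. *)
Lemma ln_diff_sqr (s t : R) : 0 < s -> 0 < t ->
  (ln s - ln t) ^+ 2 <= 4 * (s / t + t / s - 2).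
Proof.
have key (p q : R) : 0 < p -> 0 < q -> p <= q ->
    (ln p - ln q) ^+ 2 <= 4 * (p / q + q / p - 2).
  move=> p0 q0 pq; pose h := (ln q - ln p) / 2.
  have h0 : 0 <= h by rewrite divr_ge0 // subr_ge0 ler_ln ?posrE.
  have e2 : expR h ^+ 2 = q / p.
    rewrite -expRM_natl /h mulrC divfK ?pnatr_eq0 // expRD expRN !lnK ?posrE //.
  have e0 : 0 < expR h := expR_gt0 h.
  have -> : q / p = expR h ^+ 2 by [].
  have -> : p / q = (expR h ^+ 2)^-1 by rewrite e2 invf_div.
  have -> : ln p - ln q = - (2 * h) by rewrite /h mulrC divfK ?pnatr_eq0 //
    opprB.
  have h1 : 1 + h <= expR h by apply: expR_ge1Dx.
  have h2 : (expR h)^-1 <= 1 by rewrite invf_le1 //; lra.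
  have -> : (expR h ^+ 2)^-1 + expR h ^+ 2 - 2 = (expR h - (expR h)^-1) ^+ 2.
    by field; rewrite gt_eqF.
  rewrite sqrrN exprMn [2 ^+ 2](_ : _ = 4) ?ler_pM2l //;
    last by rewrite expr2; lra.
  rewrite ler_sqr ?nnegrE //; lra.
move=> s0 t0; have [st|/ltW ts] := leP s t; first exact: key.
by rewrite -sqrrN opprB [s / t + _]addrC; apply: key.
Qed.

(* Test harmonicity against [phi ^+ 2 / u]; the identity
   (u - v)(p^2/u - q^2/v) = (p - q)^2 - (p^2 v/u + q^2 u/v - 2pq)
   turns the logarithmic energy into the energy of the cutoff [phi]. *)
Lemma log_energy c (r : nat) u : (0 < r)%N -> (forall x, 0 < u x) ->
  harmonic a u ->
  energy c r (fun x => ln (u x)) <=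
  4 * ce * (((r + r).*2.+1 ^ d)%:R * (ce * (3 ^ d)%:R / r%:R ^+ 2)).
Proof.
move=> r0 u0 hu; pose phi x : R := cutoff c r r x.
pose S := box c (r + r).
pose Q x y := phi x ^+ 2 * (u y / u x) + phi y ^+ 2 * (u x / u y)
  - 2 * (phi x * phi y).
have Q0 x y : 0 <= Q x y.
  have -> : Q x y = (phi x * u y - phi y * u x) ^+ 2 / (u x * u y).
    by rewrite /Q; field; rewrite !gt_eqF.
  by rewrite divr_ge0 ?sqr_ge0 // mulr_ge0 // ltW.
have h1 : \sum_(x <- S) \sum_(y <- S) a x y * Q x y =
    \sum_(x <- S) \sum_(y <- S) a x y * (phi x - phi y) ^+ 2.
  apply/eqP; rewrite -subr_eq0 -opprB oppr_eq0 -sumrB; apply/eqP.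
  under eq_bigr do rewrite -sumrB.
  rewrite (eq_bigr (fun x => \sum_(y <- S)
    a x y * ((phi x ^+ 2 / u x - phi y ^+ 2 / u y) * (u x - u y)))); last first.
    by move=> x _; apply: eq_bigr => y _; rewrite /Q; field; rewrite !gt_eqF.
  rewrite (dirichlet_parts Ha S (fun x => phi x ^+ 2 / u x)).
  rewrite big1 ?mulr0 // => x _.
  have [->|px] := eqVneq (phi x) 0; first by rewrite expr0n !mul0r.
  rewrite (sum_weight_sub Ha _ (box_uniq _ _));
    first by rewrite [X in _ * X]hu mulr0.
  exact: cutoff_interior px.
apply: (@le_trans _ _ (4 * ce * \sum_(x <- S) \sum_(y <- S) a x y * Q x y)).
  rewrite mulr_sumr.
  apply: (@le_trans _ _ (\sum_(x <- box c r) 4 * ce * \sum_(y <- S) a x y * Q x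
    y)).
    apply: ler_sum_seq => x xb; rewrite mulr_sumr big_mkcond /= big_seq
      big_mkcond /=.
    apply: (@le_trans _ _ (\sum_(y <- box c r) 4 * ce * (a x y * Q x y))).
      apply: ler_sum => y _.
      have g0 : 0 <= 4 * ce * (a x y * Q x y).
        by rewrite !mulr_ge0 ?weight_ge0 ?(ltW (ce_gt0 Ha)) ?Q0 //
          (weight_ge0 Ha).
      case: ifP => // yb; case: ifP => // hn.
      apply: le_trans (ln_diff_sqr (u0 x) (u0 y)) _.
      rewrite -mulrA ler_pM2l // mulrA.
      have -> : u x / u y + u y / u x - 2 = Q x y.
        by rewrite /Q /phi !cutoff_in // expr1n !mul1r mulr1 [_ / _ + _]addrC.
      rewrite ler_peMl // -(divff (lt0r_neq0 (ce_gt0 Ha))) ler_pM2l ?(ce_gt0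
        Ha) //.
      exact: ell_lb hn.
    apply: sum_sub_uniq => [|y|y _]; first exact: box_uniq.
      by apply: box_sub; rewrite leq_addr.
    by rewrite !mulr_ge0 ?(ltW (ce_gt0 Ha)) ?Q0 // (weight_ge0 Ha).
  apply: sum_sub_uniq => [|y|x _]; first exact: box_uniq.
    by apply: box_sub; rewrite leq_addr.
  rewrite !mulr_ge0 ?(ltW (ce_gt0 Ha)) // sumr_ge0 // => y _.
  by rewrite mulr_ge0 ?Q0 // (weight_ge0 Ha).
rewrite h1 ler_wpM2l ?mulr_ge0 ?(ltW (ce_gt0 Ha)) //.
rewrite -(size_box c) -sum_const_seq; apply: ler_sum_seq => x xb.
by have := cutoff_gradient Ha c (r + r) r x r0; rewrite xb.
Qed.

(** By ln t <= t - 1, [lap] of [- ln u] is at most - (lap u) / u. *)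
Lemma subharmonic_Nln u : (forall x, 0 < u x) -> harmonic a u ->
  subharmonic a (fun x => - ln (u x)).
Proof.
move=> u0 hu x.
apply: (@le_trans _ _ (\sum_(y <- nbrs x) - ((u x)^-1 * (a x y * (u x - u
  y))))).
  apply: ler_sum => y _.
  have -> : - ((u x)^-1 * (a x y * (u x - u y))) = a x y * (u y / u x - 1).
    by field; rewrite gt_eqF.
  rewrite ler_wpM2l ?(weight_ge0 Ha) // opprK addrC -ln_div ?posrE //.
  have uyx : 0 < u y / u x by rewrite divr_gt0.
  by have := expR_ge1Dx (ln (u y / u x)); rewrite lnK ?posrE //; lra.
by rewrite sumrN -mulr_sumr [X in _ * X]hu mulr0 oppr0.
Qed.

(* The Poincare inequality for [ln u] bounds the sum of the squares of
   [Num.max (ln s - ln u) 0], which is subharmonic, so the mean value inequality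
   applies to it. *)
Lemma spread (delta : R) : 0 < delta -> exists2 kappa : R, 0 < kappa <= 1 &
  forall u (J : nat) c (s : R) (G : seq V),
  (forall x, 0 < u x) -> harmonic a u -> 0 < s -> uniq G ->
  {subset G <= box c (2 ^ J.+1)} -> (forall x, x \in G -> s <= u x) ->
  delta * ((2 ^ J) ^ d)%:R <= (size G)%:R ->
  forall x, x \in box c (2 ^ J) -> kappa * s <= u x.
Proof.
move=> delta0; have [eps eps0 MV] := mean_value Ha.
pose C1 : R := (5 ^ d)%:R * (13 ^ d)%:R * (16 * d%:R ^+ 2 * ce ^+ 2 * (3 ^
  d)%:R).
have C10 : 0 <= C1.
  have h1 : 0 <= d%:R ^+ 2 :> R by apply: sqr_ge0.
  have h2 : 0 <= ce ^+ 2 :> R by apply: sqr_ge0.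
  by rewrite (mulr_ge0 _ (mulr_ge0 (mulr_ge0 (mulr_ge0 _ h1) h2) _)) //
    mulr_ge0.
(* The quotient is what the energy bounds leave after division by [delta * eps]; adding 1 gives
   [K <= K ^+ 2], so that the mean value inequality applies at height [K]. *)
pose K : R := C1 * (4 ^ d)%:R / (delta * eps) + 1.
have K1 : 1 <= K by rewrite ler_wpDl // divr_ge0 //
  mulr_ge0 ?(ltW delta0) ?(ltW eps0).
exists (expR (- (2 * K))).
  rewrite expR_gt0 /= -expR0 ler_expR oppr_le0 mulr_ge0 //.
  exact: le_trans K1.
move=> u J c s G u0 hu s0 uG sG Gs hG x xb.
pose f y := ln (u y); pose r := (2 ^ J.+1)%N.
pose w := pospart (fun y => - ln (u y)) (- ln s).
suff h : w x <= 2 * K.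
  rewrite -ler_ln ?posrE ?mulr_gt0 ?expR_gt0 // lnM ?posrE ?expR_gt0 // expRK.
  by move: h; rewrite /w /pospart ge_max opprK => /andP[]; lra.
apply: (MV J c w K) => //; first exact: lt_le_trans K1.
- by move=> y; apply: pospart_ge0.
- exact/(subharmonic_pos Ha)/subharmonic_Nln.
have r0 : (0 < r)%N by rewrite expn_gt0.
(* Poincare on radius r involves translations up to 2r and the energy on radius 3r, for which
   [log_energy] needs a cutoff up to 6r; hence [5 ^ d] and [13 ^ d] in [C1]. *)
have [r3 r5 r13] : [/\ 0 < r + (r + r), (r + r).*2.+1 <= 5 * r &
    (r + (r + r) + (r + (r + r))).*2.+1 <= 13 * r]%N.
  by move: r0; move: (r) => r'; split; lia.
have G0 : 0 < (size G)%:R :> R.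
  by apply: lt_le_trans hG; rewrite mulr_gt0 // ltr0n !expn_gt0.
(* For z in [G], [f z >= ln s], hence [w y] is at most |f y - f z|; summing over z in [G] gives the
   factor [size G]. *)
have key : (size G)%:R * \sum_(y <- box c r) w y ^+ 2 <= C1 * (r ^ d)%:R ^+ 2.
  apply: (@le_trans _ _ (\sum_(y <- box c r) \sum_(z <- box c r) (f y - f z) ^+
    2)).
    rewrite mulr_sumr; apply: ler_sum_seq => y yb.
    rewrite -sum_const_seq.
    apply: (@le_trans _ _ (\sum_(z <- G) (f y - f z) ^+ 2)).
      apply: ler_sum_seq => z zG.
      have : ln s <= f z by rewrite ler_ln ?posrE // Gs.
      rewrite /w /pospart opprK /f => hz.
      have [h|h] := leP (- ln (u y) + ln s) 0.
        by rewrite expr0n sqr_ge0.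
      by rewrite -[leRHS]sqrrN ler_sqr ?nnegrE; lra.
    by apply: sum_sub_uniq => // z _; apply: sqr_ge0.
  apply: le_trans (poincare _ _ _ _) _.
  have hE := @log_energy c (r + (r + r)) u _ u0 hu.
  apply: (@le_trans _ _ ((5 ^ d * r ^ d)%:R * (d%:R * (r + r)%:R) ^+ 2 *
    (4 * ce * ((13 ^ d * r ^ d)%:R * (ce * (3 ^ d)%:R / (r + (r + r))%:R ^+
      2))))).
    apply: ler_pM; rewrite ?energy_ge0 ?mulr_ge0 ?sqr_ge0 //.
      by rewrite ler_wpM2r ?sqr_ge0 // ler_nat -expnMn leq_expn2r.
    apply: le_trans (hE r3) _.
    rewrite ler_wpM2l ?mulr_ge0 ?(ltW (ce_gt0 Ha)) // ler_wpM2r //.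
      by rewrite divr_ge0 ?sqr_ge0 // mulr_ge0 ?(ltW (ce_gt0 Ha)).
    by rewrite ler_nat -expnMn leq_expn2r.
  rewrite [leLHS](_ : _ = C1 * (r ^ d)%:R ^+ 2 / 9).
    by have := mulr_ge0 C10 (sqr_ge0 (r ^ d)%:R); lra.
  have rn : r%:R != 0 :> R by rewrite pnatr_eq0 -lt0n.
  rewrite /C1 !natrM !natrD; move: rn.
  move: (r%:R : R) ((r ^ d)%:R : R) => r' rd rn.
  have -> : r' + (r' + r') = 3 * r' by ring.
  by field.
have J0 : 0 < ((2 ^ J) ^ d)%:R :> R by rewrite ltr0n !expn_gt0.
set Sw := \sum_(y <- _) _ in key *.
have Sw0 : 0 <= Sw by apply: sumr_ge0 => y _; apply: sqr_ge0.
have k1 : delta * ((2 ^ J) ^ d)%:R * Sw <= C1 * (r ^ d)%:R ^+ 2.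
  by apply: le_trans key; rewrite ler_wpM2r.
have r2 : (r ^ d)%:R ^+ 2 = (4 ^ d)%:R * ((2 ^ J) ^ d)%:R ^+ 2 :> R.
  rewrite /r [(2 ^ J.+1)%N]expnS expnMn natrM exprMn; congr (_ * _).
  by rewrite -natrX -expnM mulnC expnM.
have {}k1 : Sw <= C1 * (4 ^ d)%:R / (delta * eps) * eps * ((2 ^ J) ^ d)%:R.
  rewrite -(ler_pM2l (mulr_gt0 delta0 J0)); apply: (le_trans k1).
  rewrite r2 le_eqVlt; apply/orP; left; apply/eqP; field.
  by rewrite !gt_eqF.
apply: (le_trans k1); rewrite ler_wpM2r // mulrC ler_wpM2l ?(ltW eps0) //.
apply: (@le_trans _ _ K); first by rewrite /K lerDl.
by rewrite expr2 ler_peMl // (le_trans _ K1).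
Qed.

End LogEstimate.

(** * From the spreading of lower bounds to Harnack and Liouville *)

Section Harnack.
Context {R : realType} {d : nat} {a : 'rV[int]_d -> 'rV[int]_d -> R} {ce : R}.
Context (Ha : elliptic_weights ce a).
Local Notation V := 'rV[int]_d.
Implicit Types (x y z c : V) (u : V -> R).

(* The last clause: [u >= u x / 2] cannot hold on a large part of the box of
   radius [2 ^ j.+1] around [x], since spreading this lower bound up to [z] would
   make [u z] too large; hence [u - u x / 2] is positive on a small set only, and
   the mean value inequality forces it to be large somewhere nearby. *)
Lemma growth : exists kappa : R, [/\ 0 < kappa <= 1,
  forall u c (j n : nat) (s : R),
    (forall x, 0 < u x) -> harmonic a u -> 0 < s ->
    (forall x, x \in box c (2 ^ j) -> s <= u x) ->
    forall x, x \in box c (2 ^ (j + n)) -> kappa ^+ n * s <= u x,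
  forall u x z (J : nat), (forall x, 0 < u x) -> harmonic a u ->
    z \in box x (2 ^ J.+1) -> kappa ^+ J.+1 * kappa * u x <= u z &
  forall u x z (j J : nat), (forall x, 0 < u x) -> harmonic a u ->
    (j <= J.+1)%N -> z \in box x (2 ^ J.+1) ->
    2 * u z < kappa ^+ (J.+1 - j) * kappa * u x ->
    exists2 x', x' \in box x (2 ^ j.+1) & 2 * u x < u x'].
Proof.
have [eps eps0 MV] := mean_value Ha.
(* 144 is the square of (3/2) / (1/8): on the exceptional set [u - u x / 2] is at most (3/2) u x,
   and the mean value inequality is applied with [K = u x / 8]. The bound by 1 lets a full box, or a
   single point at scale 1, count as a large set. *)
pose delta := Num.min 1 (eps / 144).
have delta0 : 0 < delta by rewrite lt_min ltr01 divr_gt0.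
have delta1 : delta <= 1 by rewrite ge_min lexx.
have deltae : delta <= eps / 144 by rewrite ge_min lexx orbT.
have [kappa /andP[k0 k1] spr] := spread Ha delta0.
have chain u c (j n : nat) (s : R) : (forall x, 0 < u x) -> harmonic a u ->
  0 < s ->
    (forall x, x \in box c (2 ^ j) -> s <= u x) ->
    forall x, x \in box c (2 ^ (j + n)) -> kappa ^+ n * s <= u x.
  move=> u0 hu s0 hs; elim: n => [|n IH] x.
    by rewrite addn0 expr0 mul1r; apply: hs.
  rewrite addnS exprS -mulrA => xb.
  apply: (spr u (j + n).+1 c _ (box c (2 ^ (j + n)))) => //.
  - by rewrite mulr_gt0 // exprn_gt0.
  - exact: box_uniq.
  - by apply: box_sub; rewrite leq_exp2l // leqW.
  rewrite size_box; apply: (@le_trans _ _ ((2 ^ (j + n).+1) ^ d)%:R).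
    by rewrite ler_piMl.
  by rewrite ler_nat leq_expn2r // expnS mul2n leqW.
exists kappa; split => //; first by rewrite k0 k1.
  move=> u x z J u0 hu zb; rewrite -mulrA.
  apply: (chain u x 0%N J.+1 (kappa * u x)) => //; first by rewrite mulr_gt0.
  move=> y yb; apply: (spr u 0%N x _ [:: x]) => //.
  - by move=> t; rewrite inE => /eqP ->; apply: box_center.
  - by move=> t; rewrite inE => /eqP ->.
  - by rewrite expn0 exp1n mulr1.
move=> u x z j J u0 hu jJ zb huz; apply: contrapT => hn.
have {}hn y : y \in box x (2 ^ j.+1) -> u y <= 2 * u x.
  by move=> yb; rewrite leNgt; apply/negP => h; apply: hn; exists y.
have ux0 := u0 x.
pose G := [seq y <- box x (2 ^ j.+1) | u x / 2 <= u y].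
have [hG|hG] := leP (delta * ((2 ^ j) ^ d)%:R) (size G)%:R.
  have h1 : forall y, y \in box x (2 ^ j) -> kappa * (u x / 2) <= u y.
    apply: (spr u j x _ G) => //.
    - by rewrite divr_gt0.
    - by rewrite filter_uniq ?box_uniq.
    - by move=> y; rewrite mem_filter => /andP[].
    - by move=> y; rewrite mem_filter => /andP[].
  have h2 := chain u x j (J.+1 - j)%N (kappa * (u x / 2)) u0 hu _ h1 z _.
  have : kappa ^+ (J.+1 - j) * (kappa * (u x / 2)) <= u z.
    by apply: h2; [rewrite mulr_gt0 // divr_gt0 | rewrite subnKC].
  move: huz; lra.
have := MV j x (pospart u (u x / 2)) (u x / 8) _ _ _ _ x (box_center _ _).
have -> : pospart u (u x / 2) x = u x / 2 by rewrite /pospart max_l; lra.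
move=> h; suff : u x / 2 <= 2 * (u x / 8) by lra.
apply: h.
- by rewrite divr_gt0.
- exact: pospart_ge0.
- apply: (subharmonic_pos Ha) => y; by rewrite hu.
rewrite (bigID (fun y => u x / 2 <= u y)) /= [X in _ + X]big1 ?addr0;
  last first.
  move=> y; rewrite -ltNge => /ltW h1.
  by rewrite /pospart max_r ?expr0n // subr_le0.
apply: (@le_trans _ _ (\sum_(y <- G) (3 / 2 * u x) ^+ 2)).
  rewrite -big_filter; apply: ler_sum_seq => y;
    rewrite mem_filter => /andP[h1 /hn h2].
  by rewrite /pospart max_l ?subr_ge0 // ler_sqr ?nnegrE; lra.
rewrite sum_const_seq.
apply: (@le_trans _ _ (eps / 144 * ((2 ^ j) ^ d)%:R * (3 / 2 * u x) ^+ 2)).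
  rewrite ler_wpM2r ?sqr_ge0 //; apply: le_trans (ltW hG) _.
  by rewrite ler_wpM2r.
by rewrite le_eqVlt; apply/orP; left; apply/eqP; field.
Qed.

(* If [u x] were too large, iterating the last clause of [growth] at scales
   shrinking geometrically (with [p] steps per scale) would produce points in a
   fixed box where [u] exceeds the bound valid at the finest scale. *)
Lemma harnack : exists2 C : R, 0 < C & forall u x z,
  (forall x, 0 < u x) -> harmonic a u -> u x <= C * u z.
Proof.
have [kappa [/andP[k0 k1] _ start step]] := growth.
have [p hp] := @exp2_unbounded R kappa^-1.
have {}hp : 1 <= (2 ^ p)%:R * kappa by rewrite -ler_pdivrMr // mul1r.
exists (2 / (kappa ^+ (p + 3) * kappa)).
  by rewrite divr_gt0 // mulr_gt0 // exprn_gt0.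
move=> u x z u0 hu.
(* The second condition is the room left for moving: from scale [j.+1], [p] moves of size [2 ^ j.+2]
   use half of [p * 2 ^ j.+3] and leave the other half for the smaller scales. *)
have claim (J j rho : nat) y : (j <= J.+1)%N ->
  (rho + p * 2 ^ j.+2 <= 2 ^ J.+1)%N ->
    y \in box z rho -> kappa ^+ (J.+1 - j) * kappa * u y <= 2 * u z.
  elim: j rho y => [|j IH] rho y jJ hrho yb.
    rewrite subn0; apply: (@le_trans _ _ (u z)); last by have := u0 z; lra.
    apply: start => //; rewrite box_sym; apply: box_sub yb.
    by apply: leq_trans hrho; rewrite leq_addr.
  rewrite leNgt; apply/negP => hy.
  have iter k : (k <= p)%N -> exists2 y', y' \in box z (rho + k * 2 ^ j.+2) &
      (2 ^ k)%:R * u y <= u y'.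
    elim: k => [_|k IHk kp]; first by exists y; rewrite ?mul0n ?addn0 ?mul1r.
    have [y1 y1b hy1] := IHk (ltnW kp).
    have [||y2 y2b hy2] := step u y1 z j.+1 J u0 hu jJ.
    - rewrite box_sym; apply: box_sub y1b; apply: leq_trans hrho.
      by rewrite leq_add2l; apply: leq_mul; [exact: ltnW | rewrite leq_exp2l].
    - apply: lt_le_trans hy _; rewrite ler_pM2l ?mulr_gt0 ?exprn_gt0 //.
      by apply: le_trans hy1; rewrite ler_peMl ?(ltW (u0 y)) // ler1n expn_gt0.
    exists y2.
      rewrite mulSn [(2 ^ _ + _)%N]addnC addnA; apply: box_trans y1b _.
      by move: y2b; rewrite mem_box.
    by apply: le_trans (ltW hy2); rewrite expnS natrM -mulrA ler_pM2l.
  have [y' y'b hy'] := iter p (leqnn _).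
  have h1 : (rho + p * 2 ^ j.+2 + p * 2 ^ j.+2 <= 2 ^ J.+1)%N.
    apply: leq_trans hrho.
    by rewrite -addnA leq_add2l -mulnDr addnn -mul2n -expnS.
  have := IH _ y' (ltnW jJ) h1 y'b; rewrite leNgt => /negP; apply.
  apply: (lt_le_trans hy).
  apply: (@le_trans _ _ (kappa ^+ (J.+1 - j) * kappa * ((2 ^ p)%:R * u y)));
    last first.
    by rewrite ler_pM2l ?mulr_gt0 ?exprn_gt0.
  rewrite (_ : (J.+1 - j = (J.+1 - j.+1).+1)%N); last by rewrite subSS subSn.
  move: (_ - _)%N => n; rewrite exprS.
  have -> : kappa * kappa ^+ n * kappa * ((2 ^ p)%:R * u y) =
    (2 ^ p)%:R * kappa * (kappa ^+ n * kappa * u y) by ring.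
  by rewrite ler_peMl // !mulr_ge0 ?exprn_ge0 ?(ltW k0) ?(ltW (u0 y)).
(* The scale follows the distance between the points, but the exponent is always [p + 3]: the
   constant depends on neither of them. *)
pose m := supn (x - z).
have e : ((p + 2 + m).+1 - m = p + 3)%N by rewrite -addSn addnK -addnS.
have := claim (p + 2 + m)%N m (2 ^ (p + 2 + m))%N x _ _ _; rewrite e => h.
rewrite mulrAC ler_pdivlMr ?mulr_gt0 ?exprn_gt0 // [leLHS]mulrC; apply: h.
- by rewrite leqW // leq_addl.
- rewrite [(2 ^ (p + 2 + m).+1)%N]expnS mul2n -addnn leq_add2l -addnA expnD.
  apply: leq_mul.
    exact: ltnW (ltn_expl _ _).
  by rewrite leq_exp2l.
- rewrite mem_box -/m (leq_trans (ltnW (ltn_expl m (ltnSn 1)))) //.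
  by rewrite leq_exp2l // leq_addl.
Qed.

(** Apply Harnack to [u] minus its infimum, made positive by a small [t]: all values are then at
    most C times a value as small as wished. *)
Lemma liouville u : (forall x, 0 < u x) -> harmonic a u ->
  forall x z, u x = u z.
Proof.
move=> u0 hu; have [C C0 hC] := harnack.
pose m := inf (range u).
have hinf : has_inf (range u).
  by split; [exists (u 0); exists 0 | exists 0 => _ [x _ <-]; apply: ltW].
have um x : m <= u x by apply: ge_inf; [exact: hinf.2 | exists x].
suff h x : u x = m by move=> x z; rewrite !h.
apply/eqP; rewrite eq_le um andbT; apply/ler_addgt0Pr => e e0.
pose t := e / (2 * C).
have t0 : 0 < t by rewrite divr_gt0 // mulr_gt0.
have [_ [z _ <-] hz] := inf_adherent t0 hinf.
pose v y := u y - m + t.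
have v0 y : 0 < v y by rewrite /v ltr_wpDl // subr_ge0.
have hv : harmonic a v.
  by move=> y; rewrite -(hu y); apply: eq_bigr => y' _; rewrite /v; ring.
have h1 := hC v x z v0 hv.
have h2 : C * v z <= C * (2 * t) by rewrite ler_pM2l // /v; lra.
have h3 : C * (2 * t) = e.
  by rewrite mulrCA mulrA /t mulrC divfK // gt_eqF // mulr_gt0.
by move: h1 h2; rewrite h3 /v; lra.
Qed.

End Harnack.

(** * Transience and the Green function *)

Section Sobolev.
Context {R : realType} {d : nat} (hd : (3 <= d)%N).
Local Notation V := 'rV[int]_d.
Implicit Types (x y z c : V) (f : V -> R).

Definition average c r f : R :=
  (\sum_(x <- box c r) f x) / (size (box c r))%:R.

Lemma sum_sqr_le (I : eqType) (s : seq I) (g : I -> R) :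
  (\sum_(i <- s) g i) ^+ 2 <= (size s)%:R * \sum_(i <- s) g i ^+ 2.
Proof.
suff h : 0 <= \sum_(i <- s) \sum_(j <- s) (g i - g j) ^+ 2.
  move: h; have -> : \sum_(i <- s) \sum_(j <- s) (g i - g j) ^+ 2 =
     2 * ((size s)%:R * \sum_(i <- s) g i ^+ 2 - (\sum_(i <- s) g i) ^+ 2).
    transitivity (\sum_(i <- s) ((size s)%:R * g i ^+ 2
       + \sum_(j <- s) g j ^+ 2 - 2 * (g i * \sum_(j <- s) g j))).
      apply: eq_bigr => i _; rewrite -sum_const_seq !mulr_sumr.
      by rewrite -big_split -sumrB; apply: eq_bigr => j _ /=; ring.
    rewrite sumrB big_split /= -!mulr_sumr -mulr_suml sum_const_seq; ring.
  by rewrite pmulr_rge0 // subr_ge0.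
by apply: sumr_ge0 => i _; apply: sumr_ge0 => j _; apply: sqr_ge0.
Qed.

Lemma average_diff c r r' f :
  (average c r f - average c r' f) ^+ 2 <=
  ((r + r').*2.+1 ^ d)%:R * (d%:R * (r + r')%:R) ^+ 2
    * energy c (r + (r + r')) f
    / ((size (box c r))%:R * (size (box c r'))%:R).
Proof.
have s0 k : 0 < (size (box c k))%:R :> R by rewrite ltr0n size_box expn_gt0.
have s1 := s0 r; have s2 := s0 r'.
rewrite ler_pdivlMr ?mulr_gt0 //; apply: le_trans (poincare c r r' f).
set M := (size (box c r))%:R in s1 *; set N := (size (box c r'))%:R in s2 *.
have e : average c r f - average c r' f =
    (\sum_(x <- box c r) \sum_(y <- box c r') (f x - f y)) / (M * N).
  have -> : \sum_(x <- box c r) \sum_(y <- box c r') (f x - f y) =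
      N * \sum_(x <- box c r) f x - M * \sum_(y <- box c r') f y.
    rewrite mulr_sumr -sum_const_seq -sumrB; apply: eq_bigr => x _.
    by rewrite sumrB sum_const_seq.
  by rewrite /average -/M -/N; field; rewrite !gt_eqF.
have : (\sum_(x <- box c r) \sum_(y <- box c r') (f x - f y)) ^+ 2 <=
   M * N * \sum_(x <- box c r) \sum_(y <- box c r') (f x - f y) ^+ 2.
  apply: le_trans (sum_sqr_le _ _) _; rewrite -mulrA ler_pM2l // mulr_sumr.
  by apply: ler_sum => x _; apply: sum_sqr_le.
set X := \sum_(x <- _) _; set Y := \sum_(x <- _) _ => h.
rewrite e -/X expr_div_n.
have -> : X ^+ 2 / (M * N) ^+ 2 * (M * N) = X ^+ 2 / (M * N).
  by field; rewrite !gt_eqF.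
by rewrite ler_pdivrMr ?mulr_gt0 // mulrC.
Qed.

(** The box of radius [rad 0 = 0] is a single point, so the first average is the value of [f]
    there. *)
Let rad k := (2 ^ k - 1)%N.

(** With m = 2^k the Poincare bound is of order m^2 / m^d, at most 1 / m since d >= 3. The ratio 3/4
    is a rational number whose square exceeds 1/2. *)
Lemma average_diff_dyadic c k f (B : R) :
  (forall M, energy c M f <= B) ->
  (average c (rad k) f - average c (rad k.+1) f) ^+ 2 <=
  (7 ^ d)%:R * (9 * d%:R ^+ 2) * B * ((3 / 4) ^+ k) ^+ 2.
Proof.
move=> hB; apply: le_trans (average_diff _ _ _ _) _.
have B0 : 0 <= B by apply: le_trans (hB 0%N); apply: energy_ge0.
pose m := (2 ^ k)%N; have m0 : (0 < m)%N by rewrite expn_gt0.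
have r1 : rad k = (m - 1)%N by [].
have r2 : rad k.+1 = (2 * m - 1)%N by rewrite /rad expnS.
have mm : 0 < m%:R :> R by rewrite ltr0n.
have md : 0 < (m ^ d)%:R :> R by rewrite ltr0n expn_gt0 m0.
apply: (@le_trans _ _ ((7 ^ d * m ^ d)%:R * (d%:R * (3 * m)%:R) ^+ 2 * B
   / ((m ^ d)%:R * (m ^ d)%:R))).
  apply: ler_pM; rewrite ?invr_ge0 ?mulr_ge0 ?sqr_ge0 ?energy_ge0 //.
    apply: ler_pM; rewrite ?mulr_ge0 ?sqr_ge0 ?energy_ge0 //.
    apply: ler_pM; rewrite ?sqr_ge0 //.
      by rewrite ler_nat -expnMn leq_expn2r // r1 r2; move: (m) m0 => n; lia.
    rewrite ler_sqr ?nnegrE ?mulr_ge0 // ler_wpM2l // ler_nat r1 r2.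
    by move: (m) m0 => n; lia.
  rewrite lef_pV2 ?posrE ?mulr_gt0 ?ltr0n ?size_box ?expn_gt0 //.
  rewrite -!natrM ler_nat; apply: leq_mul; apply: leq_expn2r.
    by rewrite r1; move: (m) m0 => n; lia.
  by rewrite r2; move: (m) m0 => n; lia.
rewrite [leLHS](_ : _ = (7 ^ d)%:R * (9 * d%:R ^+ 2) * B * (m%:R ^+ 2 / (m ^
  d)%:R)).
  rewrite ler_wpM2l // ?mulr_ge0 ?sqr_ge0 //.
  have h3 : (m ^ 3)%:R <= (m ^ d)%:R :> R by rewrite ler_nat leq_pexp2l.
  apply: (@le_trans _ _ (m%:R ^+ 2 / (m ^ 3)%:R)).
    rewrite ler_wpM2l ?sqr_ge0 // lef_pV2 ?posrE // ltr0n expn_gt0 m0 //.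
  rewrite natrX [leLHS](_ : _ = (m%:R)^-1); last by field; rewrite gt_eqF.
  rewrite /m natrX -exprVn -exprM mulnC exprM; apply: lerXn2r.
  - by rewrite nnegrE.
  - by rewrite nnegrE sqr_ge0.
  - lra.
rewrite !natrM; move: mm md; move: (m%:R : R) ((m ^ d)%:R : R) => p q p0 q0.
by field; rewrite gt_eqF.
Qed.

(* The averages of [f] over dyadic boxes interpolate between [f c] and 0, with
   geometrically decaying increments because [d > 2]. *)
Lemma sobolev : exists2 C : R, 0 < C & forall c f (B F : R), 0 < B ->
  (forall M, energy c M f <= B) ->
  (forall M, `|\sum_(x <- box c M) f x| <= F) -> f c ^+ 2 <= C * B.
Proof.
pose C0 : R := (7 ^ d)%:R * (9 * d%:R ^+ 2).
have C00 : 0 <= C0 by rewrite !mulr_ge0 ?sqr_ge0.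
exists (16 * C0 + 1); first by apply: ltr_wpDl => //; apply: mulr_ge0.
move=> c f B F B0 hB hF.
pose t := Num.sqrt (C0 * B).
have t2 : t ^+ 2 = C0 * B by rewrite sqr_sqrtr // mulr_ge0 // ltW.
have t0 : 0 <= t by apply: sqrtr_ge0.
have step k : `|average c (rad k) f - average c (rad k.+1) f| <=
  t * (3 / 4) ^+ k.
  rewrite -ler_sqr ?nnegrE ?mulr_ge0 ?exprn_ge0 // real_normK ?num_real //.
  by rewrite exprMn t2; apply: average_diff_dyadic.
(* 4 is the sum of the geometric series of ratio 3/4. *)
have tele n : `|f c - average c (rad n) f| <= 4 * t * (1 - (3 / 4) ^+ n).
  elim: n => [|n IH].
    rewrite /average /rad expn0 subnn size_box exp1n divr1.
    rewrite (_ : box c 0 = [:: c]) ?big_seq1 ?subrr ?normr0 ?expr0 ?subrr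
      ?mulr0 //.
    have := size_box c 0; rewrite exp1n; have := box_center c 0.
    by case: (box c 0) => [//|y [|//]]; rewrite inE => /eqP ->.
  have -> : f c - average c (rad n.+1) f = (f c - average c (rad n) f) +
     (average c (rad n) f - average c (rad n.+1) f) by rewrite addrA subrK.
  apply: le_trans (ler_normD _ _) _; apply: le_trans (lerD IH (step n)) _.
  by rewrite exprS; lra.
have F0 : 0 <= F by apply: le_trans (hF 0%N).
(* [F] only makes the averages tend to 0, and disappears in the limit. *)
have small n : `|average c (rad n) f| <= F / (2 ^ n)%:R.
  have s0 : 0 < (size (box c (rad n)))%:R :> R by rewrite ltr0n size_box
    expn_gt0.
  have n0 : 0 < (2 ^ n)%:R :> R by rewrite ltr0n expn_gt0.
  rewrite normrM normfV [`|_%:R|]ger0_norm // ler_pM ?invr_ge0 //.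
  rewrite lef_pV2 ?posrE // ler_nat size_box.
  apply: (@leq_trans ((2 ^ n) ^ d)); last first.
    by apply: leq_expn2r; rewrite /rad; have := expn_gt0 2 n; lia.
  by rewrite -[leqLHS]expn1 leq_pexp2l ?expn_gt0 // (leq_trans _ hd).
have h n : `|f c| <= 4 * t + F / (2 ^ n)%:R.
  rewrite -[f c](subrK (average c (rad n) f)).
  apply: le_trans (ler_normD _ _) _; apply: lerD (small n).
  have p0 : 0 <= (3 / 4) ^+ n :> R by rewrite exprn_ge0.
  by apply: le_trans (tele n) _; have := mulr_ge0 t0 p0; lra.
have h4 : `|f c| <= 4 * t.
  apply/ler_addgt0Pr => e e0.
  have [n hn] := exp2_unbounded (F / e).
  apply: le_trans (h n) _; rewrite lerD2l ler_pdivrMr ?ltr0n ?expn_gt0 //.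
  by rewrite mulrC -ler_pdivrMr.
rewrite -[leLHS]real_normK ?num_real //.
apply: (@le_trans _ _ ((4 * t) ^+ 2)).
  by rewrite ler_sqr ?nnegrE ?mulr_ge0.
by rewrite exprMn t2; lra.
Qed.

End Sobolev.

(** * One-step operators and reversibility *)

Section MarkovOperator.
Context {R : realType} {d : nat} {a : 'rV[int]_d -> 'rV[int]_d -> R} {ce : R}.
Context (Ha : elliptic_weights ce a) (d0 : (0 < d)%N).
Local Notation V := 'rV[int]_d.
Implicit Types (x y z c v : V) (f g : V -> R) (S : pred V).

Definition dirac_at z x : R := (x == z)%:R.

Lemma vweightE x : vweight a x = \sum_(y <- nbrs x) a x y.
Proof.
rewrite /vweight (fsbigE (nbrs x)) ?nbrs_uniq //.
  by apply: eq_bigl => y; rewrite in_setT.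
by move=> y _; rewrite mem_nbrs => h; rewrite (ell_nn Ha).
Qed.

Lemma exists_nbr x : exists y, nneighbour x y.
Proof.
exists (x + \row_j (if j == Ordinal d0 then 1 else 0)).
rewrite nneighbourE opprD addrA subrr sub0r norm1nN /norm1n (bigD1 (Ordinal
  d0)) //=.
by rewrite big1 => [|j jn]; rewrite mxE ?eqxx // (negbTE jn).
Qed.

Lemma vweight_ge x y : nneighbour x y -> ce^-1 <= vweight a x.
Proof.
move=> h; rewrite vweightE; apply: le_trans (ell_lb Ha h) _.
by apply: sum_ge_term => [|z _]; rewrite ?mem_nbrs ?(weight_ge0 Ha).
Qed.

Lemma vweight_gt0 x : 0 < vweight a x.
Proof.
have [y h] := exists_nbr x; apply: lt_le_trans (vweight_ge h).
by rewrite invr_gt0 (ce_gt0 Ha).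
Qed.

Lemma vweight_le x : vweight a x <= ce * (3 ^ d)%:R.
Proof.
rewrite vweightE; apply: (@le_trans _ _ (\sum_(y <- nbrs x) ce)).
  by apply: ler_sum_seq => y; rewrite mem_nbrs => h; apply: ell_ub h.
by rewrite sum_const_seq mulrC ler_pM2l ?(ce_gt0 Ha) // ler_nat size_nbrs.
Qed.

Lemma transition_ge0 x y : 0 <= transition a x y.
Proof. by rewrite divr_ge0 ?(weight_ge0 Ha) // ltW // vweight_gt0. Qed.

Lemma transition_nn x y : ~~ nneighbour x y -> transition a x y = 0.
Proof. by move=> h; rewrite /transition (ell_nn Ha) ?mul0r. Qed.

Lemma transitionE x y : vweight a x * transition a x y = a x y.
Proof. by rewrite mulrC divfK // gt_eqF // vweight_gt0. Qed.

Lemma transition_rev x y :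
  vweight a x * transition a x y = vweight a y * transition a y x.
Proof. by rewrite !transitionE (ell_sym Ha). Qed.

Lemma transition_lb x y : nneighbour x y ->
  ce^-1 / (ce * (3 ^ d)%:R) <= transition a x y.
Proof.
move=> h; have ce0 := ce_gt0 Ha.
rewrite ler_pM ?invr_ge0 ?(ell_lb Ha) ?(ltW ce0) ?mulr_ge0 ?(ltW ce0) //.
by rewrite lef_pV2 ?posrE ?vweight_gt0 ?vweight_le ?mulr_gt0 // ltr0n expn_gt0.
Qed.

(** Only the arrival point is restricted to [S]. Iterates describe the walk killed outside [S] from
    time 1 on, in accordance with [tau], which ignores time 0. *)
Definition walk_op S f x : R :=
  \sum_(y <- nbrs x | S y) transition a x y * f y.

Lemma walk_op_ge0 S f x : (forall y, 0 <= f y) -> 0 <= walk_op S f x.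
Proof. by move=> h; apply: sumr_ge0 => y _;
  rewrite mulr_ge0 ?transition_ge0. Qed.

Lemma walk_op_le S f g x : (forall y, f y <= g y) ->
  walk_op S f x <= walk_op S g x.
Proof. by move=> h; apply: ler_sum => y _;
  rewrite ler_wpM2l ?transition_ge0. Qed.

Lemma walk_op_leT S f x : (forall y, 0 <= f y) ->
  walk_op S f x <= walk_op predT f x.
Proof.
move=> h; rewrite /walk_op big_mkcond; apply: ler_sum => y _.
by case: ifP => _ //; rewrite mulr_ge0 ?transition_ge0.
Qed.

Lemma walk_op_sum (I : Type) (s : seq I) (k : I -> R) (f : I -> V -> R) S x :
  walk_op S (fun y => \sum_(i <- s) k i * f i y) x =
  \sum_(i <- s) k i * walk_op S (f i) x.
Proof.
rewrite /walk_op; under eq_bigr do rewrite mulr_sumr.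
rewrite exchange_big; apply: eq_bigr => i _; rewrite mulr_sumr.
by apply: eq_bigr => y _; rewrite mulrCA.
Qed.

Lemma walk_op_eq S f g x : (forall y, S y -> f y = g y) ->
  walk_op S f x = walk_op S g x.
Proof. by move=> h; apply: eq_bigr => y Sy; rewrite h. Qed.

Lemma walk_opD S f g x :
  walk_op S (fun y => f y + g y) x = walk_op S f x + walk_op S g x.
Proof. by rewrite /walk_op -big_split; apply: eq_bigr => y _;
  rewrite mulrDr. Qed.

Lemma iter_walk_op_ge0 S k f x : (forall y, 0 <= f y) ->
  0 <= iter k (walk_op S) f x.
Proof. by move=> h; elim: k x => [|k IH] x //=; apply: walk_op_ge0. Qed.

Lemma iter_walk_op_le S k f g x : (forall y, f y <= g y) ->
  iter k (walk_op S) f x <= iter k (walk_op S) g x.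
Proof. by move=> h; elim: k x => [|k IH] x //=; apply: walk_op_le. Qed.

Lemma iter_walk_op_leT S k f x : (forall y, 0 <= f y) ->
  iter k (walk_op S) f x <= iter k (walk_op predT) f x.
Proof.
move=> h; elim: k x => [|k IH] x //=.
apply: (@le_trans _ _ (walk_op S (iter k (walk_op predT) f) x)).
  exact: walk_op_le.
by apply: walk_op_leT => y; apply: iter_walk_op_ge0.
Qed.

Lemma iter_walk_op_sum (I : Type) (s : seq I) (q : I -> R)
    (f : I -> V -> R) S k x :
  iter k (walk_op S) (fun y => \sum_(i <- s) q i * f i y) x =
  \sum_(i <- s) q i * iter k (walk_op S) (f i) x.
Proof.
elim: k x => [|k IH] x //=; rewrite -walk_op_sum.
by apply: walk_op_eq => y _; apply: IH.
Qed.

Lemma iter_walk_op_eq S k f g x : (forall y, f y = g y) ->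
  iter k (walk_op S) f x = iter k (walk_op S) g x.
Proof. by move=> h; elim: k x => [|k IH] x //=; apply: walk_op_eq. Qed.

Lemma iter_walk_opD S k f g x : iter k (walk_op S) (fun y => f y + g y) x =
  iter k (walk_op S) f x + iter k (walk_op S) g x.
Proof.
elim: k x => [|k IH] x //=; rewrite -walk_opD.
by apply: walk_op_eq => y _; apply: IH.
Qed.

Lemma walk_op_dirac S z x : S z -> walk_op S (dirac_at z) x = transition a x z.
Proof.
move=> Sz; rewrite /walk_op big_mkcond /=.
rewrite (eq_bigr (fun y => if y == z then transition a x z else 0)); last first.
  by move=> y _; rewrite /dirac_at; case: eqVneq => [->|_];
    rewrite ?Sz ?mulr1 // mulr0 if_same.
rewrite -big_mkcond /= -big_filter.
have [h|h] := boolP (nneighbour x z).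
  rewrite (perm_big [:: z]) ?big_seq1 //=; apply: uniq_perm => //.
    exact/filter_uniq/nbrs_uniq.
  move=> y; rewrite mem_filter mem_nbrs inE.
  by case: eqVneq => // ->.
by rewrite big1_seq ?transition_nn.
Qed.

(* The weight of the paths of [k.+1] steps from [x] to [y] whose interior lies in
   [S]; reversing these paths gives [hit_op_rev]. *)
Definition hit_op S k y x : R :=
  iter k (walk_op S) (walk_op predT (dirac_at y)) x.

Lemma hit_op_rev S k x y :
  vweight a x * hit_op S k y x = vweight a y * hit_op S k x y.
Proof.
elim: k x y => [|k IH] x y; first by rewrite /hit_op /= !walk_op_dirac //
  transition_rev.
(* This expansion singles out the last interior point of the path, while unfolding [hit_op] singles
   out the first: they mirror each other. *)
have -> : hit_op S k.+1 x y =
   \sum_(v <- nbrs x | S v) transition a v x * hit_op S k v y.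
  rewrite /hit_op iterSr -big_filter.
  rewrite -(@iter_walk_op_sum _ _ (fun v => transition a v x)
    (fun v => walk_op predT (dirac_at v))).
  apply: iter_walk_op_eq => t.
  rewrite (@walk_op_eq _ _ (fun v => transition a v x)); last first.
    by move=> v _; rewrite walk_op_dirac.
  rewrite /walk_op -big_filter [RHS](eq_bigr (fun v =>
    transition a t v * transition a v x)).
    apply: eq_sum_support => [||v]; [exact/filter_uniq/nbrs_uniq..|].
    rewrite !(mem_filter S) !mem_nbrs => hv; congr (_ && _).
    have [h1|h1] := boolP (nneighbour t v); last first.
      by move: hv; rewrite transition_nn // mul0r eqxx.
    have [h2|h2] := boolP (nneighbour v x); last first.
      by move: hv; rewrite (transition_nn h2) mulr0 eqxx.
    by rewrite nneighbour_sym h2.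
  by move=> v _; rewrite -/(walk_op predT (dirac_at v) t) walk_op_dirac //
    mulrC.
rewrite {1}/hit_op /= /walk_op !mulr_sumr; apply: eq_bigr => v Sv.
rewrite mulrA transition_rev -mulrA -/(hit_op S k y v) [LHS]mulrCA IH.
by rewrite mulrCA.
Qed.

End MarkovOperator.
Arguments walk_op {R d} a S f x.
Arguments hit_op {R d} a S k y x.

Lemma cvgn_unique (R : realType) (u : nat -> R) (l l' : R) :
  u n @[n --> \oo] --> l -> u n @[n --> \oo] --> l' -> l = l'.
Proof.
move=> h h'; rewrite -(cvg_lim (@norm_hausdorff _ _) h).
exact: (cvg_lim (@norm_hausdorff _ _) h').
Qed.

Lemma cvg_sum_seq (R : realType) (I T : Type) (F : set_system T) (FF : Filter F)
    (s : seq I) (Q : pred I) (f : I -> T -> R) (l : I -> R) :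
  (forall i, Q i -> f i t @[t --> F] --> l i) ->
  \sum_(i <- s | Q i) f i t @[t --> F] --> \sum_(i <- s | Q i) l i.
Proof.
move=> h; elim: s => [|i s IH].
  rewrite big_nil; under eq_fun do rewrite big_nil; exact: cvg_cst.
rewrite big_cons; under eq_fun do rewrite big_cons.
by case: ifP => // /h hi; apply: cvgD.
Qed.

(** * The Green function: finiteness, symmetry, positivity *)

Section Green.
Context {R : realType} {d : nat} {a : 'rV[int]_d -> 'rV[int]_d -> R} {ce : R}.
Context (Ha : elliptic_weights ce a) (hd : (3 <= d)%N).
Local Notation V := 'rV[int]_d.
Local Notation P := (walk_op a predT).
Local Notation dl := (@dirac_at R d).
Implicit Types (x y z c v : V) (f g : V -> R).

Let d0 : (0 < d)%N. Proof. exact: leq_trans hd. Qed.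

(** Expected number of visits to [z] before time [N] from [x]: the target comes first, so
    [green a z x] is the usual G(x, z). *)
Definition green_sum N z x : R := \sum_(0 <= k < N) iter k P (dl z) x.

Lemma dirac_at_ge0 z x : 0 <= dl z x.
Proof. by rewrite /dirac_at. Qed.

Lemma iter_dirac_supp k z x : iter k P (dl z) x != 0 -> x \in box z k.
Proof.
elim: k x => [|k IH] x /=.
  rewrite /dirac_at; case: (eqVneq x z) => [-> _|_]; first exact: box_center.
  by rewrite eqxx.
apply: contraR => xb; apply/eqP; rewrite /walk_op big1_seq // => y /andP[_].
rewrite mem_nbrs => hn; have [->|/IH hy] := eqVneq (iter k P (dl z) y) 0.
  by rewrite mulr0.
case/negP: xb; apply: box_nneighbour hy _; by rewrite nneighbour_sym.
Qed.

Lemma green_sum_supp N z x : green_sum N z x != 0 -> x \in box z N.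
Proof.
apply: contraR => xb; apply/eqP;
  rewrite /green_sum big_nat big1 // => k /andP[_ kN].
apply/eqP; apply: contraNT xb => /iter_dirac_supp; apply: box_sub; exact: ltnW.
Qed.

Lemma green_sum_ge0 N z x : 0 <= green_sum N z x.
Proof.
by apply: sumr_ge0 => k _; apply: (iter_walk_op_ge0 Ha d0) => y;
  apply: dirac_at_ge0.
Qed.

Lemma green_sumS N z x : green_sum N.+1 z x = dl z x + P (green_sum N z) x.
Proof.
rewrite /green_sum big_nat_recl //=; congr (_ + _).
under eq_bigr do rewrite -[walk_op _ _ _ _]mul1r.
rewrite -(walk_op_sum _ (fun=> 1)); apply: walk_op_eq => y _.
by apply: eq_bigr => i _; rewrite mul1r.
Qed.

Lemma lap_green_sum N z x : lap a (green_sum N z) x =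
  vweight a x * (dl z x - iter N P (dl z) x).
Proof.
have -> : dl z x - iter N P (dl z) x = green_sum N z x - P (green_sum N z) x.
  have := green_sumS N z x.
  rewrite {1}/green_sum big_nat_recr //= -/(green_sum N z x); lra.
rewrite mulrBr {1}(vweightE Ha) mulr_suml /walk_op mulr_sumr -sumrB.
by apply: eq_bigr => y _; rewrite mulrBr [in RHS]mulrA (transitionE Ha d0).
Qed.

Lemma energy_subbox c c' M M' f : {subset box c M <= box c' M'} ->
  energy c M f <= energy c' M' f.
Proof.
move=> h; apply: (@le_trans _ _ (\sum_(x <- box c M)
    \sum_(y <- box c' M' | nneighbour x y) (f x - f y) ^+ 2)).
  apply: ler_sum => x _; rewrite -[leLHS]big_filter -[leRHS]big_filter.
  apply: sum_sub_uniq.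
  - exact/filter_uniq/box_uniq.
  - by move=> y; rewrite mem_filter => /andP[hn /h yb]; rewrite mem_filter hn.
  - by move=> y _; apply: sqr_ge0.
apply: sum_sub_uniq => //; first exact: box_uniq.
by move=> x _; apply: sumr_ge0 => y _; apply: sqr_ge0.
Qed.

Lemma box_subbox c z M : {subset box c M <= box z (supn (c - z) + M)}.
Proof.
move=> x; rewrite !mem_box => h; rewrite -(subrK c x) -addrA.
by rewrite (leq_trans (supnD _ _)) // addnC leq_add2l.
Qed.

(** The box is enlarged until it contains the support and its neighbours, where summation by parts
    is exact. By [lap_green_sum], only the term at [z] contributes positively. *)
Lemma energy_green_sum N z c M :
  energy c M (green_sum N z) <= 2 * ce * (vweight a z * green_sum N z z).
Proof.
pose M' := (supn (c - z) + M + N.+1)%N.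
have sub : {subset box c M <= box z M'}.
  by move=> x /(@box_subbox c z M); apply: box_sub; rewrite leq_addr.
apply: le_trans (energy_subbox _ sub) _.
apply: le_trans (energy_le_weight Ha _ _ _) _.
rewrite [2 * ce]mulrC -mulrA ler_pM2l ?(ce_gt0 Ha) //.
under eq_bigr do under eq_bigr do rewrite expr2.
rewrite (dirichlet_parts Ha) ler_pM2l //.
apply: (@le_trans _ _ (\sum_(x <- box z M') (if x == z then
    vweight a z * green_sum N z z else 0))).
  apply: ler_sum => x _.
  have [g0|/green_sum_supp xb] := eqVneq (green_sum N z x) 0.
    rewrite g0 mul0r; case: eqP => // <-.
    by rewrite mulr_ge0 ?green_sum_ge0 // ltW // (vweight_gt0 Ha d0).
  rewrite (sum_weight_sub Ha _ (box_uniq _ _)); last first.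
    move=> y; rewrite mem_nbrs => /(box_nneighbour xb).
    by apply: box_sub; rewrite /M' leq_addl.
  rewrite -/(lap a (green_sum N z) x) lap_green_sum.
  have i0 : 0 <= iter N P (dl z) x.
    by apply: (iter_walk_op_ge0 Ha d0) => y; apply: dirac_at_ge0.
  have w0 := vweight_gt0 Ha d0 x; have g0 := green_sum_ge0 N z x.
  move: i0 w0 g0; rewrite /dirac_at; case: eqVneq => [->|_] /= i0 w0 g0.
    by rewrite mulrCA ler_pM2l // ler_piMr //; lra.
  by rewrite sub0r mulrN mulrN oppr_le0 !mulr_ge0 // ltW.
rewrite -big_mkcond -big_filter (perm_big [:: z]) ?big_seq1 //.
apply: uniq_perm => [|//|x]; first exact/filter_uniq/box_uniq.
rewrite mem_filter inE /=; by case: (eqVneq x z) => [->|//]; rewrite box_center.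
Qed.

(* [green_sum N z] has energy at most of the order of its value at [z], while
   [sobolev] bounds the square of that value by the energy. *)
Lemma green_sum_bounded : exists C : R, forall N z x, green_sum N z x <= C.
Proof.
have [C C0 hC] := @sobolev R d hd.
have ce0 := ce_gt0 Ha.
have D0 : 0 < ce * (3 ^ d)%:R by rewrite mulr_gt0 // ltr0n expn_gt0.
pose K := C * (2 * ce * (ce * (3 ^ d)%:R)).
have K0 : 0 < K by rewrite !mulr_gt0 // ltr0n expn_gt0.
have key N z x : (0 < N)%N ->
    green_sum N z x ^+ 2 <= K * green_sum N z z.
  move=> N0; have g1 : 1 <= green_sum N z z.
    case: N N0 => // N _; rewrite green_sumS /dirac_at eqxx lerDl.
    by apply: (walk_op_ge0 Ha d0) => y; apply: green_sum_ge0.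
  have g0 : 0 < green_sum N z z by apply: lt_le_trans g1.
  have w0 := vweight_gt0 Ha d0 z.
  apply: (@le_trans _ _ (C * (2 * ce * (vweight a z * green_sum N z z)))).
    apply: (hC x _ _ (\sum_(y <- box z N) green_sum N z y)).
    - by rewrite !mulr_gt0.
    - by move=> M; apply: energy_green_sum.
    move=> M; rewrite ger0_norm; last first.
      by apply: sumr_ge0 => y _; apply: green_sum_ge0.
    rewrite (bigID (mem (box z N))) /= [X in _ + X]big1 ?addr0.
      rewrite -big_filter; apply: sum_sub_uniq.
      - exact/filter_uniq/box_uniq.
      - by move=> y; rewrite mem_filter => /andP[].
      - by move=> y _; apply: green_sum_ge0.
    move=> y yb; apply/eqP; apply: contraNT yb; exact: green_sum_supp.
  rewrite /K -!mulrA ler_pM2l // ler_pM2l // ler_pM2l // mulrA.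
  by rewrite ler_pM2r // vweight_le.
exists K => -[|N] z x; first by rewrite /green_sum big_geq // ltW.
have h1 : green_sum N.+1 z z <= K.
  have := key N.+1 z z isT; rewrite expr2.
  have [->|gn] := eqVneq (green_sum N.+1 z z) 0; first by rewrite (ltW K0).
  by rewrite ler_pM2r // lt_neqAle eq_sym gn green_sum_ge0.
have : green_sum N.+1 z x ^+ 2 <= K ^+ 2.
  by apply: le_trans (key N.+1 z x isT) _; rewrite expr2 ler_pM2l.
by rewrite ler_sqr ?nnegrE ?green_sum_ge0 ?(ltW K0).
Qed.

Definition green z x : R := limn (fun N => green_sum N z x).

Lemma green_sum_nondecreasing z x :
  nondecreasing_seq (fun N => green_sum N z x).
Proof.
apply/nondecreasing_seqP => N; rewrite /green_sum big_nat_recr //= lerDl.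
by apply: (iter_walk_op_ge0 Ha d0) => y; apply: dirac_at_ge0.
Qed.

Lemma cvg_green z x : green_sum N z x @[N --> \oo] --> green z x.
Proof.
have [C hC] := green_sum_bounded.
apply: nondecreasing_is_cvgn; first exact: green_sum_nondecreasing.
by exists C => _ [N _ <-].
Qed.

Lemma green_sum_le N z x : green_sum N z x <= green z x.
Proof.
apply: nondecreasing_cvgn_le; first exact: green_sum_nondecreasing.
by apply/cvg_ex; exists (green z x); apply: cvg_green.
Qed.

Lemma green_ge0 z x : 0 <= green z x.
Proof. exact: le_trans (green_sum_ge0 0 z x) (green_sum_le 0 z x). Qed.

Lemma cvg_walk_op S (f : nat -> V -> R) g x :
  (forall y, f N y @[N --> \oo] --> g y) ->
  walk_op a S (f N) x @[N --> \oo] --> walk_op a S g x.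
Proof.
move=> h; rewrite /walk_op.
by apply: cvg_sum_seq => y _; apply: cvgMr.
Qed.

Lemma greenE z x : green z x = dl z x + P (green z) x.
Proof.
apply: (@cvgn_unique _ (fun N => green_sum N.+1 z x)).
  by have := @cvg_green z x; rewrite -(cvg_shiftS (fun N => green_sum N z x)).
under eq_fun do rewrite green_sumS.
apply: cvgD; first exact: cvg_cst.
by apply: cvg_walk_op => y; apply: cvg_green.
Qed.

Lemma iter_green n z x : iter n P (green z) x = green z x - green_sum n z x.
Proof.
elim: n x => [|n IH] x; first by rewrite /green_sum big_geq // subr0.
rewrite iterSr.
rewrite (@iter_walk_op_eq _ _ a _ _ _ (fun y => green z y + -1 * dl z y));
  last first.
  by move=> y; rewrite (greenE z y); lra.
rewrite iter_walk_opD IH {2}/green_sum big_nat_recr //= -/(green_sum n z x).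
have -> : iter n P (fun y => -1 * dl z y) x = - iter n P (dl z) x.
  have := @iter_walk_op_sum R d a _ [:: tt] (fun=> -1) (fun=> dl z) predT n x.
  by rewrite big_seq1 mulN1r => <-; apply: iter_walk_op_eq => y;
    rewrite big_seq1.
by rewrite opprD addrA.
Qed.

Lemma iter_green_cvg0 z x : iter n P (green z) x @[n --> \oo] --> 0.
Proof.
under eq_fun do rewrite iter_green.
rewrite -(subrr (green z x)); apply: cvgB; [exact: cvg_cst | exact: cvg_green].
Qed.

Lemma green_rev x z : vweight a x * green z x = vweight a z * green x z.
Proof.
have h N : vweight a x * green_sum N z x = vweight a z * green_sum N x z.
  rewrite /green_sum !mulr_sumr; apply: eq_bigr => -[_|k _].
    by rewrite /= /dirac_at eq_sym; case: eqVneq => [->//|_]; rewrite !mulr0.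
  have := hit_op_rev Ha d0 predT k x z.
  by rewrite /hit_op -!iterSr.
apply: (@cvgn_unique _ (fun N => vweight a x * green_sum N z x)).
  by apply: cvgMr; apply: cvg_green.
under eq_fun do rewrite h.
by apply: cvgMr; apply: cvg_green.
Qed.

Lemma green_diag_ge1 z : 1 <= green z z.
Proof.
rewrite greenE /dirac_at eqxx lerDl.
by apply: (walk_op_ge0 Ha d0) => y; apply: green_ge0.
Qed.

Lemma green_nbr x v w : nneighbour v w ->
  ce^-1 / (ce * (3 ^ d)%:R) * green x w <= green x v.
Proof.
move=> h; rewrite (greenE x v).
apply: (@le_trans _ _ (P (green x) v)); last by rewrite lerDr dirac_at_ge0.
apply: (@le_trans _ _ (transition a v w * green x w)).
  by rewrite ler_wpM2r ?green_ge0 // (transition_lb Ha d0).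
apply: (@sum_ge_term R _ _ (fun y => transition a v y * green x y)).
  by rewrite mem_nbrs.
by move=> y _; rewrite mulr_ge0 ?green_ge0 // (transition_ge0 Ha d0).
Qed.

(** The constant does not depend on the pole [x], which confines the ratios of Green functions to a
    compact interval as [x] goes to infinity. *)
Lemma green_chain v w :
  exists2 q : R, 0 < q & forall x, q * green x w <= green x v.
Proof.
move En : (norm1n (w - v)) => n; elim: n w En => [|n IH] w En.
  exists 1 => // x; rewrite mul1r.
  by have /eqP := norm1n_eq0 En; rewrite subr_eq0 => /eqP ->.
have [e [e1 en _]] := norm1n_step En.
have [|q q0 hq] := IH (w - e); first by rewrite -en addrAC.
exists (q * (ce^-1 / (ce * (3 ^ d)%:R))).
  have ce0 := ce_gt0 Ha.
  by rewrite mulr_gt0 // divr_gt0 ?invr_gt0 ?mulr_gt0 // ltr0n expn_gt0.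
move=> x; apply: le_trans (hq x); rewrite -mulrA ler_pM2l //.
by apply: green_nbr; rewrite nneighbourE addrAC subrr sub0r norm1nN e1.
Qed.

Lemma green_gt0 x v : 0 < green x v.
Proof.
have [q q0 hq] := green_chain v x; apply: lt_le_trans (hq x).
by rewrite mulr_gt0 // (lt_le_trans ltr01) // green_diag_ge1.
Qed.

End Green.
Arguments green {R d} a z x.
Arguments green_sum {R d} a N z x.

Lemma cvg_sum_mem (R : realType) (I : eqType) (T : Type) (F : set_system T)
    (FF : Filter F) (s : seq I) (f : I -> T -> R) (l : I -> R) :
  (forall i, i \in s -> f i t @[t --> F] --> l i) ->
  \sum_(i <- s) f i t @[t --> F] --> \sum_(i <- s) l i.
Proof.
move=> h; rewrite [X in _ --> X]big_seq.
have -> : (fun t => \sum_(i <- s) f i t) = (fun t =>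
  \sum_(i <- s | i \in s) f i t).
  by apply/funext => t; rewrite big_seq.
exact: cvg_sum_seq.
Qed.

(** * Green function ratios at infinity and hitting probabilities *)

(** Finite sets are bounded for any finite-valued [g], so a limit along this filter is also one for
    |x| and for D(x, A) tending to infinity. *)
Definition cofinite_filter (T : Type) : set_system T :=
  [set B | finite_set (~` B)].

Instance cofinite_filter_filter (T : Type) : Filter (@cofinite_filter T).
Proof.
split => [|A B fA fB|A B AB]; rewrite /cofinite_filter /=.
- by rewrite setCT.
- by rewrite setCI finite_setU.
- by apply: sub_finite_set; apply: subsetC.
Qed.

Lemma fmap_ultra (T U : Type) (f : T -> U) (F : set_system T) :
  UltraFilter F -> UltraFilter (fmap f F).
Proof.
move=> UF; split; first exact: fmap_proper_filter.
move=> G GF FG; apply/seteqP; split => [A GA|]; last exact: FG.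
have [//|nA] := in_ultra_setVsetC (f @^-1` A) UF.
have GnA : G (~` A) by apply: FG.
have h : G set0 by rewrite -(setICr A); apply: filterI.
by case: (filter_not_empty G h).
Qed.

Lemma ultra_bounded_cvg (R : realType) (T : Type) (F : set_system T)
    (r : T -> R) (m M : R) : UltraFilter F -> (forall t, m <= r t <= M) ->
  exists2 k : R, m <= k <= M & r t @[t --> F] --> k.
Proof.
move=> UF hr; have := @segment_compact R m M; rewrite compact_ultra.
move=> /(_ _ (fmap_ultra r UF)) [].
  rewrite /fmap /=; apply: (@filterE _ F) => t.
  by rewrite /= in_itv /=; apply: hr.
by move=> k [/=]; rewrite in_itv /= => hk rk; exists k.
Qed.

Section GreenRatio.
Context {R : realType} {d : nat} {a : 'rV[int]_d -> 'rV[int]_d -> R} {ce : R}.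
Context (Ha : elliptic_weights ce a) (hd : (3 <= d)%N).
Local Notation V := 'rV[int]_d.
Implicit Types (x y z c v : V) (f g : V -> R).

Let d0 : (0 < d)%N. Proof. exact: leq_trans hd. Qed.

(* Along an ultrafilter at infinity the normalised Green functions converge
   pointwise to a positive harmonic function, which is constant. *)
Lemma green_ratio z0 z :
  green a x z / green a x z0 @[x --> @cofinite_filter V] --> (1 : R).
Proof.
apply/cvgrPdist_lt => e e0.
pose B := ~` [set x | `|1 - green a x z / green a x z0| < e].
suff : finite_set B by [].
apply: contrapT => Binf.
(* The sets containing all but finitely many points of the bad set [B]. A finer ultrafilter contains
   [B] and leaves every point. *)
pose F : set_system V := [set C | finite_set (B `\` C)].
have FF : ProperFilter F.
  split; first by rewrite /F /= setD0.
  split => [|C D|C D CD]; rewrite /F /=.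
  - by rewrite setDT.
  - by rewrite setDIr finite_setU.
  - by apply: sub_finite_set; apply: setDS.
have [U [UU FU]] := ultraFilterLemma FF.
have UB : U B by apply: FU; rewrite /F /= setDv.
have Uneq w : U [set x | x != w].
  apply: FU; apply: sub_finite_set (finite_set1 w) => x [_ /= /negP].
  by rewrite negbK => /eqP.
have lim w : exists2 k : R, 0 < k & green a x w / green a x z0 @[x --> U] --> k.
  have [q q0 hq] := green_chain Ha hd z0 w.
  have [q' q'0 hq'] := green_chain Ha hd w z0.
  have [|k /andP[k0 _] hk] := @ultra_bounded_cvg _ _ U
    (fun x => green a x w / green a x z0) q' q^-1 UU.
    move=> x; have g0 := green_gt0 Ha hd x z0.
    apply/andP; split; first by rewrite ler_pdivlMr.
    by rewrite ler_pdivrMr // ler_pdivlMl.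
  by exists k => //; apply: lt_le_trans k0.
have /choice[k hk] : forall w, exists k : R,
    0 < k /\ green a x w / green a x z0 @[x --> U] --> k.
  by move=> w; have [k h1 h2] := lim w; exists k.
have PU : ProperFilter U by apply: ultra_proper.
(* [green a x] is harmonic off [x], which differs from [w] eventually along [U]; the finite sums in
   [lap] pass to the limit. *)
have hkh : harmonic a k.
  move=> w; have h1 : lap a (fun v => green a x v / green a x z0) w @[x --> U]
      --> lap a k w.
    apply: cvg_sum_seq => v _; apply: cvgMr.
    by apply: cvgB; apply: (hk _).2.
  have h2 : lap a (fun v => green a x v / green a x z0) w @[x --> U] --> (0 :
    R).
    apply: cvg_near_cst; apply: filterS (Uneq w) => x /= xw.
    have -> : lap a (fun v => green a x v / green a x z0) w =
        (\sum_(y <- nbrs w) a w y * (green a x w - green a x y)) / green a x z0.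
      by rewrite mulr_suml; apply: eq_bigr => y _; ring.
    under eq_bigr do rewrite mulrBr; rewrite sumrB -mulr_suml -(vweightE Ha).
    rewrite (greenE Ha hd) /dirac_at eq_sym (negbTE xw) add0r /walk_op
      mulr_sumr.
    rewrite -sumrB big1 ?mul0r // => y _.
    by rewrite mulrA (transitionE Ha d0) subrr.
  rewrite -(cvg_lim (@norm_hausdorff _ _) h1).
  exact: (cvg_lim (@norm_hausdorff _ _) h2).
have k1 : k z0 = 1.
  have h2 : green a x z0 / green a x z0 @[x --> U] --> (1 : R).
    apply: cvg_near_cst; apply: filterE => x.
    by rewrite divff // gt_eqF // (green_gt0 Ha hd).
  rewrite -(cvg_lim (@norm_hausdorff _ _) (hk z0).2).
  exact: (cvg_lim (@norm_hausdorff _ _) h2).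
have kz : k z = 1.
  by rewrite -k1; apply: (liouville Ha _ hkh) => w; have [] := hk w.
have /cvgrPdist_lt /(_ e e0) := (hk z).2; rewrite kz => h.
have h2 : U (B `&` [set x | `|1 - green a x z / green a x z0| < e]).
  exact: filterI.
by have [x [xB hx]] := filter_ex h2; apply: xB.
Qed.

End GreenRatio.

(** * The hitting law of a finite set through its Green matrix *)

Section Hitting.
Context {R : realType} {d : nat} {a : 'rV[int]_d -> 'rV[int]_d -> R} {ce : R}.
Context (Ha : elliptic_weights ce a) (hd : (3 <= d)%N).
Local Notation V := 'rV[int]_d.
Local Notation P := (walk_op a predT).
Implicit Types (x y z c v : V) (f g : V -> R).

Let d0 : (0 < d)%N. Proof. exact: leq_trans hd. Qed.

Context (s : seq V) (us : uniq s) (H : V -> V -> R).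
Let S : pred V := fun v => v \notin s.
Hypothesis cvg_H : forall x y, y \in s ->
  \sum_(0 <= k < n) hit_op a S k y x @[n --> \oo] --> H x y.

Lemma walk_op_split f x : P f x =
  \sum_(y <- s) f y * transition a x y + walk_op a S f x.
Proof.
rewrite /walk_op (bigID S) /= addrC; congr (_ + _).
rewrite -big_filter (eq_bigr (fun y => f y * transition a x y)); last first.
  by move=> y _; rewrite mulrC.
apply: eq_sum_support => [||y]; [exact/filter_uniq/nbrs_uniq | exact: us |].
rewrite mem_filter mem_nbrs negbK => h; rewrite andb_idr // => _.
by apply: contraNT h => hn; rewrite (transition_nn Ha) // mulr0.
Qed.

(* Follow the walk until its first visit to [s], or for [n] steps. *)
Lemma hit_decomposition n f x : (forall v, v \notin s -> f v = P f v) ->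
  P f x = \sum_(y <- s) f y * \sum_(0 <= k < n) hit_op a S k y x
    + iter n (walk_op a S) (P f) x.
Proof.
move=> hf; elim: n => [|n IH].
  by rewrite big1 ?add0r // => y _; rewrite big_geq // mulr0.
rewrite {1}IH; under [in RHS]eq_bigr do rewrite big_nat_recr //= mulrDr.
rewrite big_split /= -addrA; congr (_ + _).
rewrite -/(iter n.+1 (walk_op a S) (P f) x) iterSr.
rewrite -(iter_walk_op_sum s f (fun y => P (dirac_at y))) -iter_walk_opD.
apply: iter_walk_op_eq => v; rewrite walk_op_split; congr (_ + _).
  by apply: eq_bigr => y _; rewrite (walk_op_dirac Ha).
by apply: walk_op_eq => u Su; apply: hf.
Qed.

(** Let [n] tend to infinity in [hit_decomposition]: the remainder is at most an iterate of the walk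
    operator on [green a z], that is, a tail of the Green series. *)
Lemma hit_green x z : z \in s ->
  green a z x = dirac_at z x + \sum_(y <- s) H x y * green a z y.
Proof.
move=> zs; rewrite (greenE Ha hd); congr (_ + _).
pose rem n := iter n (walk_op a S) (P (green a z)) x.
have hrem : rem n @[n --> \oo] --> (0 : R).
  apply: (@squeeze_cvgr _ _ _ _ (fun=> 0) (fun n => iter n.+1 P (green a z) x)).
  - have p0 y : 0 <= P (green a z) y.
      by apply: (walk_op_ge0 Ha d0) => t; apply: green_ge0 Ha hd _ _.
    apply: nearW => m; rewrite iterSr; apply/andP; split.
      exact: (iter_walk_op_ge0 Ha d0).
    exact: (iter_walk_op_leT Ha d0).
  - exact: cvg_cst.
  - have := @iter_green_cvg0 _ _ _ _ Ha hd z x.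
    by rewrite -(cvg_shiftS (fun m => iter m P (green a z) x)).
apply: (@cvgn_unique _ (fun=> P (green a z) x)); first exact: cvg_cst.
have e n : P (green a z) x =
    \sum_(y <- s) green a z y * \sum_(0 <= k < n) hit_op a S k y x + rem n.
  apply: hit_decomposition => v vs; rewrite {1}(greenE Ha hd) /dirac_at.
  by case: eqVneq vs => [->|_ _]; rewrite ?zs ?add0r.
rewrite -[X in _ --> X]addr0; under eq_fun => n do rewrite (e n).
apply: cvgD => //.
under [X in _ --> X]eq_bigr do rewrite mulrC.
by apply: cvg_sum_mem => y ys; apply: cvgMr; apply: cvg_H.
Qed.

Let n := size s.
Let Gmx : 'M[R]_n := \matrix_(i, j) green a (nth 0 s j) (nth 0 s i).
Let Hmx : 'M[R]_n := \matrix_(i, j) H (nth 0 s i) (nth 0 s j).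

Lemma sum_nth_ord f : \sum_(y <- s) f y = \sum_(i < n) f (nth 0 s i).
Proof. by rewrite (big_nth 0) big_mkord. Qed.

(* [hit_green] reads [(1 - Hmx) *m Gmx = 1] on [s]. *)
Lemma green_inverse : Gmx *m (1%:M - Hmx) = 1%:M.
Proof.
apply: mulmx1C; apply/matrixP => i j.
rewrite mulmxBl mul1mx !mxE (hit_green (nth 0 s i)) ?mem_nth //.
rewrite sum_nth_ord /dirac_at nth_uniq // -addrA.
rewrite [X in _ + X](_ : _ = 0) ?addr0 //.
by apply/eqP; rewrite subr_eq0; apply/eqP/eq_bigr => k _; rewrite !mxE.
Qed.

(** For [x] outside [s], [hit_green] says that the row of the G(x, z) is the row of the [H x v]
    times [Gmx]; multiply on the right by the inverse [1 - Hmx]. *)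
Lemma hit_potential x y : x \notin s -> y \in s ->
  H x y = \sum_(z <- s) green a z x * (dirac_at y z - H z y).
Proof.
move=> xs ys.
have -> : \sum_(z <- s) green a z x * (dirac_at y z - H z y) =
    \sum_(z <- s) \sum_(v <- s) H x v * (green a z v * (dirac_at y z - H z y)).
  rewrite big_seq [RHS]big_seq; apply: eq_bigr => z zs.
  rewrite hit_green // /dirac_at; case: eqVneq zs xs => [->->//|_ _ _].
  by rewrite add0r mulr_suml; apply: eq_bigr => v _; rewrite mulrA.
rewrite exchange_big /=; pose j := Ordinal (etrans (index_mem y s) ys).
have yj : y = nth 0 s j by rewrite nth_index.
rewrite sum_nth_ord; under eq_bigr => i _.
  rewrite -mulr_sumr sum_nth_ord.
  have -> : \sum_(k < n) green a (nth 0 s k) (nth 0 s i) *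
    (dirac_at y (nth 0 s k) - H (nth 0 s k) y) = (i == j)%:R.
    have /matrixP /(_ i j) := green_inverse; rewrite !mxE => <-.
    by apply: eq_bigr => k _; rewrite !mxE {1}yj /dirac_at nth_uniq // -yj.
  over.
rewrite (bigD1 j) //= eqxx mulr1 -yj big1 ?addr0 // => i ij.
by rewrite (negbTE ij) mulr0.
Qed.

Lemma hit_rev x y : x \in s -> y \in s ->
  vweight a x * H x y = vweight a y * H y x.
Proof.
move=> xs ys.
apply: (@cvgn_unique _ (fun n => vweight a x * \sum_(0 <=
  k < n) hit_op a S k y x)).
  by apply: cvgMr; apply: cvg_H.
under eq_fun => m do rewrite mulr_sumr (eq_bigr _ (fun k _ =>
  hit_op_rev Ha d0 S k x y))
  -mulr_sumr.
by apply: cvgMr; apply: cvg_H.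
Qed.

Definition escape z : R := 1 - \sum_(y <- s) H z y.

(** If every escape probability vanished, [1 - Hmx] would kill the constant vector, although it is
    invertible. *)
Lemma escape_sum_gt0 : s != [::] -> (forall z, z \in s -> 0 <= escape z) ->
  0 < \sum_(z <- s) vweight a z * escape z.
Proof.
move=> s0 he.
have t0 z : z \in s -> 0 <= vweight a z * escape z.
  by move=> zs; rewrite mulr_ge0 ?he // ltW // (vweight_gt0 Ha d0).
rewrite lt_neqAle sumr_ge0_seq // andbT eq_sym; apply/negP => /eqP h.
have e0 z : z \in s -> escape z = 0.
  move=> zs; apply/eqP.
  have : vweight a z * escape z <= 0.
    by rewrite -h; apply: (@sum_ge_term R _ s (fun z =>
      vweight a z * escape z)).
  by rewrite pmulr_rle0 ?(vweight_gt0 Ha d0) // eq_le he // andbT.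
have n0 : (0 < n)%N by rewrite lt0n size_eq0.
have h1 : (1%:M - Hmx) *m (const_mx 1 : 'cV[R]_n) = 0.
  apply/matrixP => i j; rewrite mulmxBl mul1mx !mxE.
  apply: etrans (e0 (nth 0 s i) (mem_nth _ (ltn_ord i))).
  rewrite /escape sum_nth_ord; congr (_ - _).
  by apply: eq_bigr => k _; rewrite !mxE mulr1.
have := congr1 (mulmx^~ (const_mx 1 : 'cV[R]_n)) green_inverse.
rewrite /= -mulmxA h1 mulmx0 mul1mx => /matrixP /(_ (Ordinal n0) 0).
by rewrite !mxE => /eqP; rewrite eq_sym oner_eq0.
Qed.

Lemma hit_ratio_cvg y : y \in s -> (forall z, z \in s -> 0 <= escape z) ->
  H x y / \sum_(v <- s) H x v @[x --> @cofinite_filter V] -->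
  vweight a y * escape y / \sum_(z <- s) vweight a z * escape z.
Proof.
move=> ys he.
have s0 : s != [::] by apply: contraTneq ys => ->.
have D0 := escape_sum_gt0 s0 he.
pose rho z x := green a x z / green a x y.
pose nu z := vweight a z * (dirac_at y z - H z y).
have hN : \sum_(z <- s) rho z x * nu z @[x --> @cofinite_filter V] -->
    \sum_(z <- s) 1 * nu z.
  by apply: cvg_sum_seq => z _; apply: cvgMl; apply: (green_ratio Ha hd).
have hD : \sum_(z <- s) rho z x * (vweight a z * escape z)
    @[x --> @cofinite_filter V] --> \sum_(z <- s) 1 * (vweight a z * escape z).
  by apply: cvg_sum_seq => z _; apply: cvgMl; apply: (green_ratio Ha hd).
(* Reversibility turns the sum of the [H z y] over the starting point into one over the endpoint,
   which is what [escape] contains. *)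
have eN : \sum_(z <- s) 1 * nu z = vweight a y * escape y.
  rewrite /escape mulrBr mulr1 mulr_sumr /nu.
  under eq_bigr do rewrite mul1r mulrBr; rewrite sumrB; congr (_ - _).
    rewrite (bigD1_seq y) //= /dirac_at eqxx mulr1 big1 ?addr0 // => z zy.
    by rewrite (negbTE zy) mulr0.
  by rewrite big_seq [RHS]big_seq; apply: eq_bigr => z zs; apply: hit_rev.
have eD : \sum_(z <- s) 1 * (vweight a z * escape z) =
    \sum_(z <- s) vweight a z * escape z by under eq_bigr do rewrite mul1r.
rewrite eN in hN; rewrite eD in hD.
have hq := cvgM hN (cvgV (lt0r_neq0 D0) hD).
apply: (cvg_trans _ (hq _ _)); apply: near_eq_cvg.
have : (@cofinite_filter V) [set x | x \notin s].
  apply: sub_finite_set (finite_seq s) => x /= /negP; by rewrite negbK.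
apply: filterS => x /= xs.
have w0 := vweight_gt0 Ha d0 x; have g0 := green_gt0 Ha hd x y.
(* The prefactor, the only quantity here with no limit, is common to numerator and denominator. *)
have key (g : V -> R) : \sum_(z <- s) green a z x * g z =
    green a x y / vweight a x * \sum_(z <- s) rho z x * (vweight a z * g z).
  rewrite mulr_sumr; apply: eq_bigr => z _.
  have : green a z x = vweight a z * green a x z / vweight a x.
    by rewrite -(green_rev Ha hd) mulrC mulKf // gt_eqF.
  by rewrite /rho => ->; field; rewrite !gt_eqF.
have hx : \sum_(v <- s) H x v = \sum_(z <- s) green a z x * escape z.
  rewrite (eq_big_seq (fun v => \sum_(z <- s) green a z x * (dirac_at v z - H z
    v))).
    rewrite exchange_big /=; apply: eq_big_seq => z zs.
    rewrite -mulr_sumr; congr (_ * _); rewrite sumrB; congr (_ - _).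
    rewrite (bigD1_seq z) //= /dirac_at eqxx big1 ?addr0 // => v vz.
    by rewrite eq_sym (negbTE vz).
  by move=> v vs; apply: hit_potential.
rewrite hx (hit_potential xs ys) !key.
rewrite -/(nu _); set A := \sum_(z <- s) _; set B := \sum_(z <- s) _.
rewrite invfM mulrACA divff ?mul1r //.
by rewrite mulf_neq0 ?invr_eq0 // gt_eqF.
Qed.

End Hitting.

(** * The law of the walk *)

Section Prob.
Context {R : realType} {disp : measure_display} {T : measurableType disp}.
Implicit Types (Q : probability T R) (E F : set T).

Lemma probE Q E : measurable E -> (prob Q E)%:E = Q E.
Proof. by move=> mE; rewrite /prob fineK // fin_num_measure. Qed.

Lemma prob_ge0 Q E : 0 <= prob Q E.
Proof. exact: fine_ge0. Qed.

Lemma probU Q E F : measurable E -> measurable F -> E `&` F = set0 ->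
  prob Q (E `|` F) = prob Q E + prob Q F.
Proof.
move=> mE mF EF; apply: EFin_inj; rewrite EFinD !probE //;
  last exact: measurableU.
exact: measureU.
Qed.

Lemma prob_le Q E F : measurable E -> measurable F -> E `<=` F ->
  prob Q E <= prob Q F.
Proof.
by move=> mE mF EF; rewrite -lee_fin !probE // le_measure ?inE.
Qed.

Lemma probC Q E : measurable E -> prob Q (~` E) = 1 - prob Q E.
Proof.
move=> mE; apply: EFin_inj; rewrite EFinB !probE //; last exact: measurableC.
exact: probability_setC.
Qed.

Lemma prob_eq0P Q E : measurable E -> prob Q E = 0 <-> Q.-negligible E.
Proof.
move=> mE; split => h.
  by apply/(negligibleP Q mE); exact: etrans (esym (probE Q mE)) (congr1 EFin
    h).
by have /(negligibleP Q mE) e := h; rewrite /prob [X in fine X]e.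
Qed.

Lemma prob_le_negligible Q E F Z : measurable E -> measurable F ->
  Q.-negligible Z -> E `<=` F `|` Z -> prob Q E <= prob Q F.
Proof.
move=> mE mF [N [mN N0 ZN]] EFZ.
have N0' : prob Q (N `\` F) = 0.
  apply/prob_eq0P; first exact: measurableD.
  by exists N; split => // x [].
rewrite -[leRHS]addr0 -N0' -probU //; last 2 first.
- exact: measurableD.
- exact: setDIK.
apply: prob_le => //; first by apply: measurableU => //; exact: measurableD.
move=> x /EFZ [Fx|/ZN Nx]; first by left.
by have [Fx|nFx] := pselect (F x); [left | right].
Qed.

Lemma prob_sum Q (I : eqType) (s : seq I) (F : I -> set T) : uniq s ->
  (forall i, measurable (F i)) ->
  (forall i j w, F i w -> F j w -> i = j) ->
  measurable [set w | exists2 i, i \in s & F i w] /\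
  prob Q [set w | exists2 i, i \in s & F i w] = \sum_(i <- s) prob Q (F i).
Proof.
move=> us mF dF; elim: s us => [_|i s IH /= /andP[si us]].
  have -> : [set w | exists2 i, i \in [::] & F i w] = set0.
    by apply/seteqP; split => // w [].
  by rewrite big_nil /prob measure0; split.
have [mS pS] := IH us.
have e : [set w | exists2 j, j \in i :: s & F j w] =
    F i `|` [set w | exists2 j, j \in s & F j w].
  apply/seteqP; split => w.
    by case=> j; rewrite inE => /orP[/eqP ->|js] Fj; [left | right; exists j].
  by case=> [Fi|[j js Fj]]; [exists i | exists j];
    rewrite ?mem_head // inE js orbT.
rewrite e; split; first exact: measurableU.
rewrite probU // ?big_cons ?pS //.
apply/seteqP; split => // w [Fi [j js Fj]].
by move: si; rewrite (dF _ _ _ Fi Fj) js.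
Qed.

Lemma measurable_forall (D : nat -> set T) : (forall i, measurable (D i)) ->
  measurable [set w | forall i, D i w].
Proof.
move=> mD; have -> : [set w | forall i, D i w] = \bigcap_i D i.
  by apply/seteqP; split => w h i //; apply: h.
exact: bigcapT_measurable.
Qed.

Lemma measurable_imply (b : bool) (D : set T) : measurable D ->
  measurable [set w | b -> D w].
Proof.
case: b => mD; last by rewrite (_ : [set _ | _] = setT) //; apply/seteqP; split.
by rewrite (_ : [set _ | _] = D) //; apply/seteqP; split => w /=; [apply|].
Qed.

Lemma prob_partition Q (V : countType) (Y : T -> V) (s : seq V) E :
  uniq s -> measurable E -> (forall v, measurable [set w | Y w = v]) ->
  (forall v, v \notin s -> prob Q (E `&` [set w | Y w = v]) = 0) ->
  prob Q E = \sum_(v <- s) prob Q (E `&` [set w | Y w = v]).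
Proof.
move=> us mE mY h0.
have mF v : measurable (E `&` [set w | Y w = v]) by apply: measurableI.
have [|mU <-] := @prob_sum Q V s (fun v => E `&` [set w | Y w = v]) us mF.
  by move=> i j w [_ <-] [_ <-].
apply/eqP; rewrite eq_le; apply/andP; split; last first.
  by apply: prob_le => // w [v _ []].
pose Z n := if unpickle n is Some v then
  if v \in s then set0 else E `&` [set w | Y w = v] else set0.
apply: (@prob_le_negligible _ _ _ (\bigcup_n Z n)) => //.
  apply: negligible_bigcup => n; rewrite /Z; case: unpickle => [v|]; last first.
    exact: negligible_set0.
  case: ifPn => vs; first exact: negligible_set0.
  by apply/prob_eq0P => //; apply: h0.
move=> w Ew; have [ys|ys] := boolP (Y w \in s); first by left; exists (Y w).
by right; exists (pickle (Y w)) => //; rewrite /Z pickleK (negbTE ys).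
Qed.

End Prob.

Section WalkLaw.
Context {R : realType} {d : nat} {a : 'rV[int]_d -> 'rV[int]_d -> R} {ce : R}.
Context (Ha : elliptic_weights ce a) (d0 : (0 < d)%N).
Local Notation V := 'rV[int]_d.
Context {disp : measure_display} {T : measurableType disp}
  {P : V -> probability T R} {X : nat -> T -> V} (hX : random_walk a P X).
Implicit Types (x y z v : V) (B : pred V) (l : seq (pred V)).

Definition cylinder k (s : nat -> V) : set T :=
  [set w | forall i, (i <= k)%N -> X i w = s i].

Definition visits k l : set T :=
  [set w | forall i, (i < size l)%N -> nth xpredT l i (X (k.+1 + i)%N w)].

Definition path_weight l : V -> R :=
  foldr (fun B f => walk_op a B f) (fun=> 1) l.

Lemma measurable_walk k (Q : V -> Prop) : measurable [set w | Q (X k w)].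
Proof. exact: (walk_measurable hX k [set v | Q v]). Qed.

Lemma measurable_cylinder k s : measurable (cylinder k s).
Proof.
apply: measurable_forall => i; apply: measurable_imply.
exact: (measurable_walk i (fun v => v = s i)).
Qed.

Lemma measurable_visits k l : measurable (visits k l).
Proof.
apply: measurable_forall => i; apply: measurable_imply.
exact: (measurable_walk _ (fun v => nth xpredT l i v)).
Qed.

Lemma prob_cylinderS x k s : prob (P x) (cylinder k.+1 s) =
  prob (P x) (cylinder k s) * transition a (s k) (s k.+1).
Proof.
apply: EFin_inj; rewrite EFinM !probE; [|exact: measurable_cylinder..].
exact: (walk_markov hX).
Qed.

(** [walk_markov] only speaks of fully prescribed trajectories; splitting according to the value of
    [X k.+1] extends it to constraints at later times. *)
Lemma walk_law x k s l : prob (P x) (cylinder k s `&` visits k l) =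
  prob (P x) (cylinder k s) * path_weight l (s k).
Proof.
elim: l k s => [|B l IH] k s.
  by rewrite mulr1 (_ : visits k [::] = setT) ?setIT //; apply/seteqP; split.
pose upd v i := if i == k.+1 then v else s i.
have eU v : cylinder k.+1 (upd v) = cylinder k s `&` [set w | X k.+1 w = v].
  apply/seteqP; split => w.
    move=> h; split; last by have := h k.+1 (leqnn _); rewrite /upd eqxx.
    by move=> i ik; have := h i (leqW ik); rewrite /upd ltn_eqF.
  move=> [h1 h2] i; rewrite leq_eqVlt /upd; case: eqP => [-> _ //|_ /=].
  exact: h1.
have pU v : prob (P x) (cylinder k.+1 (upd v)) =
    prob (P x) (cylinder k s) * transition a (s k) v.
  rewrite prob_cylinderS /upd eqxx ltn_eqF //; congr (prob _ _ * _).
  by apply/seteqP; split => w h i ik; have := h i ik; rewrite ltn_eqF.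
have eV v : cylinder k s `&` visits k (B :: l) `&` [set w | X k.+1 w = v] =
    if B v then cylinder k.+1 (upd v) `&` visits k.+1 l else set0.
  case: ifPn => Bv; last first.
    apply/seteqP; split => // w [[_ h] hv]; have := h 0%N isT.
    by rewrite addn0 /= hv (negbTE Bv).
  rewrite eU; apply/seteqP; split => w.
    move=> [[h1 h2] h3]; split => // i il; have := h2 i.+1 il.
    by rewrite addnS -addSn.
  move=> [[h1 h3] h2]; split=> //; split => // -[_|i il];
    first by rewrite addn0 /= h3.
  by have := h2 i il; rewrite addnS -addSn.
rewrite (@prob_partition _ _ _ _ _ (X k.+1) (nbrs (s k))).
- rewrite /= /walk_op mulr_sumr [RHS]big_mkcond; apply: eq_bigr => v _.
  rewrite eV; case: ifP => _; last by rewrite /prob measure0.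
  by rewrite IH pU mulrA /upd eqxx.
- exact: nbrs_uniq.
- by apply: measurableI; [exact: measurable_cylinder | exact:
    measurable_visits].
- by move=> v; apply: (measurable_walk k.+1 (fun u => u = v)).
- move=> v; rewrite mem_nbrs eV => hv; case: ifP => _;
    last by rewrite /prob measure0.
  by rewrite IH pU (transition_nn Ha) // mulr0 mul0r.
Qed.

Lemma prob_start x : prob (P x) [set w | X 0%N w = x] = 1.
Proof. by rewrite /prob (walk_start hX). Qed.

Lemma start_negligible x : (P x).-negligible [set w | X 0%N w <> x].
Proof.
have m0 := measurable_walk 0 (fun v => v = x).
apply/prob_eq0P; first exact: (measurable_walk 0 (fun v => v <> x)).
by have := probC (P x) m0; rewrite prob_start subrr.
Qed.

(** The start at [x] is only almost sure, so the cylinder of length 0 has to be removed up to a null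
    set. *)
Lemma prob_visits x l : prob (P x) (visits 0 l) = path_weight l x.
Proof.
have c0 : cylinder 0 (fun=> x) = [set w | X 0%N w = x].
  apply/seteqP; split => w; first exact.
  by move=> h i; rewrite leqn0 => /eqP ->.
have := walk_law x 0 (fun=> x) l; rewrite c0 prob_start mul1r => <-.
have mV := measurable_visits 0 l.
have m0 := measurable_walk 0 (fun v => v = x).
apply/eqP; rewrite eq_le; apply/andP; split.
  apply: (prob_le_negligible _ _ (start_negligible x)) => //.
    exact: measurableI.
  move=> w Vw; have [h|h] := pselect (X 0%N w = x); first by left.
  by right.
by apply: prob_le; [exact: measurableI | exact: mV | exact: subIsetr].
Qed.

End WalkLaw.
Arguments visits {d disp T} X k l.
Arguments path_weight {R d} a l.

(** * Hitting and exit times *)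

Section GraphDistance.
Context {R : realType} {d : nat}.
Local Notation V := 'rV[int]_d.
Implicit Types (x y : V).

Lemma path_norm1n x p : path (@nneighbour d) x p ->
  (norm1n (x - last x p)%R <= size p)%N.
Proof.
elim: p x => [|y p IH] x /=; first by rewrite subrr norm1n0.
move=> /andP[xy /IH h]; rewrite -(subrK y x) -addrA.
apply: leq_trans (norm1nD _ _) _; apply: (@leq_add _ _ 1) => //.
by move: xy; rewrite nneighbourE => /eqP ->.
Qed.

Lemma gdistE x y : gdist R x y = (norm1n (x - y)%R)%:R%:E.
Proof.
apply/eqP; rewrite eq_le; apply/andP; split; last first.
  apply: le_ereal_inf_tmp => _ [p [hp <-] <-].
  by rewrite lee_fin ler_nat path_norm1n.
suff [p [h1 h2 h3]] : exists p, [/\ path (@nneighbour d) x p, last x p = y &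
    size p = norm1n (x - y)%R].
  by apply: ereal_inf_lbound; exists p => //; rewrite h3.
move En : (norm1n (x - y)%R) => n; elim: n x En => [|n IH] x En.
  by exists [::]; split => //=; apply/eqP; rewrite -subr_eq0;
    apply/eqP/norm1n_eq0.
have [e [e1 en _]] := norm1n_step En.
have [|p [h1 h2 h3]] := IH (x - e); first by rewrite -en addrAC.
exists (x - e :: p); split => //=; last by rewrite h3.
by rewrite h1 nneighbourE opprB addrC subrK e1.
Qed.

Lemma gballE (m : nat) : gball 0 (m%:R : R) = [set x : V | (norm1n x < m)%N].
Proof.
by apply/seteqP; split => x; rewrite /gball /= gdistE sub0r norm1nN lte_fin
  ltr_nat.
Qed.

Lemma cofinite_tends_to_pinfty (g : V -> \bar R) (B : set V) :
  (forall x, (g x < +oo)%E) -> cofinite_filter B -> tends_to_pinfty g B.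
Proof.
move=> hg /finite_seqP[s hs].
have [M hM] : exists M : R, forall x, x \in s -> (g x <= M%:E)%E.
  elim: s {hs} => [|x s [M IH]]; first by exists 0.
  have [m hm] : exists m : R, (g x <= m%:E)%E.
    by case: (g x) (hg x) => [r _| |] //; [exists r | exists 0; rewrite leNye].
  exists (Num.max m M) => y; rewrite inE => /orP[/eqP ->|/IH h].
    by apply: le_trans hm _; rewrite lee_fin le_max lexx.
  by apply: le_trans h _; rewrite lee_fin le_max lexx orbT.
exists M => // x /= Mx; apply: contrapT => nB.
have xs : x \in s by have : (~` B) x by []; rewrite hs.
by have := hM x xs; rewrite leNgt Mx.
Qed.

End GraphDistance.

Section HittingTimes.
Context {R : realType} {d : nat} {disp : measure_display}
  {T : measurableType disp}.
Local Notation V := 'rV[int]_d.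
Context (X : nat -> T -> V).
Implicit Types (C D : set V) (w : T).

Lemma hit_from_ltP k0 C k1 D w :
  ((hit_from k0 X C w : \bar R) < hit_from k1 X D w)%E <->
  exists n, [/\ (k0 <= n)%N, C (X n w) &
    forall i, (k1 <= i <= n)%N -> ~ D (X i w)].
Proof.
split.
  move=> /ereal_inf_lt [_ [n [kn Cn] <-] hn]; exists n;
    split => // i /andP[ki ni] Di.
  have : (hit_from k1 X D w <= (i%:R%:E : \bar R))%E.
    by apply: ereal_inf_lbound; exists i.
  by apply/negP; rewrite -ltNge; apply: le_lt_trans hn; rewrite lee_fin ler_nat.
move=> [n [kn Cn hn]]; apply: (@le_lt_trans _ _ (n%:R%:E)).
  by apply: ereal_inf_lbound; exists n.
apply: (@lt_le_trans _ _ (n.+1%:R%:E)); first by rewrite lte_fin ltr_nat.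
apply: le_ereal_inf_tmp => _ [i [ki Di] <-]; rewrite lee_fin ler_nat ltnNge.
by apply/negP => ni; apply: (hn i); rewrite ?ki.
Qed.

Lemma tau_ltyP D w : ((tau X D w : \bar R) < +oo)%E <->
  exists2 n, (0 < n)%N & D (X n w).
Proof.
split; first by move=> /ereal_inf_lt [_ [n [kn Dn] <-] _]; exists n.
move=> [n n0 Dn]; apply: (@le_lt_trans _ _ (n%:R%:E)); last exact: ltry.
by apply: ereal_inf_lbound; exists n.
Qed.

Lemma tau_eqP D w n : (tau X D w = n%:R%:E :> \bar R) <->
  [/\ (0 < n)%N, D (X n w) & forall i, (0 < i < n)%N -> ~ D (X i w)].
Proof.
split => [e|[n0 Dn hn]].
  have lb i : (0 < i)%N -> D (X i w) -> (n <= i)%N.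
    move=> i0 Di; rewrite -(ler_nat R) -lee_fin -e.
    by apply: ereal_inf_lbound; exists i.
  have : ((tau X D w : \bar R) < n.+1%:R%:E)%E by rewrite e lte_fin ltr_nat.
  move=> /ereal_inf_lt [_ [k [k0 Dk] <-]]; rewrite lte_fin ltr_nat ltnS => kn.
  have kn' : k = n by apply/eqP; rewrite eqn_leq kn lb.
  rewrite -kn'; split => // i /andP[i0 ik] Di.
  by have := lb i i0 Di; rewrite -kn' leqNgt ik.
apply/eqP; rewrite eq_le; apply/andP; split.
  by apply: ereal_inf_lbound; exists n.
apply: le_ereal_inf_tmp => _ [i [i0 Di] <-]; rewrite lee_fin ler_nat leqNgt.
by apply/negP => ni; apply: (hn i); rewrite ?i0.
Qed.

End HittingTimes.

(** * First visit to a finite set and escape probability *)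

Section HittingLaw.
Context {R : realType} {d : nat} {a : 'rV[int]_d -> 'rV[int]_d -> R} {ce : R}.
Context (Ha : elliptic_weights ce a) (hd : (3 <= d)%N).
Local Notation V := 'rV[int]_d.
Context {disp : measure_display} {T : measurableType disp}
  {P : V -> probability T R} {X : nat -> T -> V} (hX : random_walk a P X).
Context (s : seq V) (us : uniq s).
Implicit Types (x y z v : V).

Let d0 : (0 < d)%N. Proof. exact: leq_trans hd. Qed.
Let A : set V := [set v | v \in s].
Let S : pred V := fun v => v \notin s.

Definition hit_prob x y : R := prob (P x) (hits_at (R := R) X A y).

(** For [y] in [s], this is the event that [tau] equals [k.+1] and the walk is then at [y]; [k]
    counts the interior points, as in [hit_op]. *)
Definition first_hit k y := visits X 0 (rcons (nseq k S) (pred1 y)).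

Lemma path_weight_cat l l' x :
  path_weight a (l ++ l') x =
  foldr (fun B f => walk_op a B f) (path_weight a l') l x.
Proof. by rewrite /path_weight foldr_cat. Qed.

Lemma path_weight_nseq k B l x : path_weight a (nseq k B ++ l) x =
  iter k (walk_op a B) (path_weight a l) x.
Proof. by rewrite path_weight_cat; elim: k x => //= k IH x;
  apply: walk_op_eq. Qed.

Lemma path_weight1 (B : pred V) x :
  path_weight a [:: B] x = walk_op a B (fun=> 1) x.
Proof. by []. Qed.

Lemma walk_op_pred1 y x :
  walk_op a (pred1 y) (fun=> 1) x = walk_op a predT (dirac_at y) x.
Proof.
rewrite /walk_op big_mkcond /=; apply: eq_bigr => v _.
by rewrite /dirac_at; case: eqP => _; rewrite ?mulr1 ?mulr0.
Qed.

Lemma prob_first_hit k x y : prob (P x) (first_hit k y) = hit_op a S k y x.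
Proof.
rewrite (prob_visits Ha hX) -cats1 path_weight_nseq.
by apply: iter_walk_op_eq => v; rewrite path_weight1 walk_op_pred1.
Qed.

Lemma first_hitP k y w : first_hit k y w <->
  (forall i, (0 < i <= k)%N -> X i w \notin s) /\ X k.+1 w = y.
Proof.
split => [h|[h1 h2] i].
  split; last first.
    have := h k; rewrite size_rcons size_nseq ltnSn => /(_ isT).
    by rewrite nth_rcons size_nseq ltnn eqxx add1n => /eqP.
  move=> [|i] // /andP[_ ik]; have := h i.
  rewrite size_rcons size_nseq ltnS => /(_ (ltnW ik)).
  by rewrite nth_rcons size_nseq ik nth_nseq ik add1n.
rewrite size_rcons size_nseq ltnS leq_eqVlt => /orP[/eqP ->|ik].
  by rewrite nth_rcons size_nseq ltnn eqxx add1n /= h2.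
by rewrite nth_rcons size_nseq ik nth_nseq ik add1n /S h1.
Qed.

Lemma hits_atE y : y \in s -> hits_at (R := R) X A y = \bigcup_k first_hit k y.
Proof.
move=> ys; apply/seteqP; split => w.
  move=> [[|k]] /tau_eqP [k0 _ hk] Xk //.
  exists k => //; apply/first_hitP; split => // i hi.
  by apply/negP; apply: hk.
move=> [k _ /first_hitP [h1 h2]]; exists k.+1 => //; apply/tau_eqP.
split => //; first by rewrite h2.
by move=> i hi; apply/negP; apply: h1.
Qed.

Lemma measurable_first_hit k y : measurable (first_hit k y).
Proof. exact: (measurable_visits hX). Qed.

Lemma measurable_hits_at y : y \in s -> measurable (hits_at (R := R) X A y).
Proof.
move=> ys; rewrite hits_atE //; apply: bigcup_measurable => k _.
exact: measurable_first_hit.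
Qed.

Lemma first_hit_inj k k' y y' w : y \in s -> y' \in s ->
  first_hit k y w -> first_hit k' y' w -> k = k'.
Proof.
move=> ys ys' /first_hitP [h1 h2] /first_hitP [h1' h2'].
have [kk|kk|//] := ltngtP k k'.
  by have := h1' k.+1; rewrite kk h2 ys => /(_ isT).
by have := h1 k'.+1; rewrite kk h2' ys' => /(_ isT).
Qed.

Lemma cvg_hit_prob x y : y \in s ->
  \sum_(0 <= k < n) hit_op a S k y x @[n --> \oo] --> hit_prob x y.
Proof.
move=> ys; have mF k := measurable_first_hit k y.
have tF : trivIset setT (fun k => first_hit k y).
  apply/trivIsetP => i j _ _ ij; apply/seteqP; split => // w [h1 h2].
  by move: ij; rewrite (first_hit_inj ys ys h1 h2) eqxx.
have mU : measurable (\bigcup_k first_hit k y).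
  by rewrite -hits_atE //; apply: measurable_hits_at.
have := @measure_semi_sigma_additive _ _ _ (P x) _ mF tF mU.
rewrite -hits_atE // => h.
suff h2 : (\sum_(0 <= k < n) hit_op a S k y x)%:E @[n --> \oo] -->
    (hit_prob x y)%:E.
  exact: (fine_cvg h2).
rewrite /hit_prob probE; last exact: measurable_hits_at.
under eq_fun => n.
  rewrite -sumEFin; under eq_bigr => k _ do
    rewrite -prob_first_hit (probE _ (measurable_first_hit k y)).
  over.
exact: h.
Qed.

Definition finite_tau : set T := [set w | (tau X A w < +oo :> \bar R)%E].

Lemma finite_tauE :
  finite_tau = [set w | exists2 y, y \in s & hits_at (R := R) X A y w].
Proof.
apply/seteqP; split => w.
  move=> /tau_ltyP h.
  have h' : exists n, (0 < n)%N && (X n w \in s).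
    by have [n n0 An] := h; exists n; rewrite n0.
  have [n /andP[n0 ns] hmin] := ex_minnP h'.
  exists (X n w) => //; exists n => //; apply/tau_eqP; split => //.
  move=> i /andP[i0 ilt] Ai; have := hmin i.
  by rewrite i0 Ai leqNgt ilt => /(_ isT).
move=> [y ys [n hn _]]; rewrite /finite_tau /= hn; exact: ltry.
Qed.

Lemma prob_finite_tau x : measurable finite_tau /\
  prob (P x) finite_tau = \sum_(y <- s) hit_prob x y.
Proof.
rewrite finite_tauE.
pose F y := if y \in s then hits_at (R := R) X A y else set0.
have [||mU pU] := @prob_sum _ _ _ (P x) _ s F us.
- by move=> y; rewrite /F; case: ifP => [/measurable_hits_at|].
- move=> y y' w; rewrite /F; case: ifP => // ys; case: ifP => // ys'.
  move=> [n hn <-] [n' hn' <-]; move: hn'; rewrite hn => -[e].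
  suff -> : n = n' by [].
  by apply/eqP; rewrite -(eqr_nat R); apply/eqP.
have e : [set w | exists2 y, y \in s & hits_at (R := R) X A y w] =
    [set w | exists2 y, y \in s & F y w].
  by apply/seteqP; split => w [y ys hy]; exists y => //; move: hy;
    rewrite /F ys.
rewrite e; split => //; rewrite pU; apply: eq_big_seq => y ys.
by rewrite /F ys.
Qed.

Lemma HbarE x y : y \in s ->
  Hbar P X A x y = hit_prob x y / \sum_(v <- s) hit_prob x v.
Proof.
move=> ys; rewrite /Hbar /cond_prob -(prob_finite_tau x).2;
  congr (prob _ _ / _).
apply: setIidl; rewrite -/finite_tau finite_tauE => w h; by exists y.
Qed.

Definition avoid n : set T := visits X 0 (nseq n S).

Lemma avoidP n w : avoid n w <-> forall i, (0 < i <= n)%N -> X i w \notin s.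
Proof.
split => [h [|i] // /andP[_ ik]|h i].
  by have := h i; rewrite size_nseq nth_nseq ik add1n; apply.
by rewrite size_nseq nth_nseq => ik; rewrite ik add1n /S h.
Qed.

Lemma escapeE x : escape s hit_prob x = prob (P x) (~` finite_tau).
Proof.
have [m e] := prob_finite_tau x.
by rewrite probC // e.
Qed.

Lemma escape_ge0 x : 0 <= escape s hit_prob x.
Proof. by rewrite escapeE prob_ge0. Qed.

Lemma measurable_avoid n : measurable (avoid n).
Proof. exact: (measurable_visits hX). Qed.

Lemma cvg_avoid x : prob (P x) (avoid n) @[n --> \oo] --> escape s hit_prob x.
Proof.
have e : ~` finite_tau = \bigcap_n avoid n.
  apply/seteqP; split => w.
    move=> h n _; apply/avoidP => i /andP[i0 _]; apply/negP => Xi; apply: h.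
    by apply/tau_ltyP; exists i.
  move=> h /tau_ltyP [n n0 An]; have /avoidP := h n I.
  by move=> /(_ n); rewrite n0 leqnn => /(_ isT); rewrite An.
rewrite escapeE.
have mc : measurable (~` finite_tau) by apply/measurableC/(prob_finite_tau x).1.
suff h : (prob (P x) (avoid n))%:E @[n --> \oo] -->
    (prob (P x) (~` finite_tau))%:E.
  exact: (fine_cvg h).
rewrite probE // e; under eq_fun => n do rewrite (probE _ (measurable_avoid n)).
apply: (@nonincreasing_cvg_mu _ _ _ (P x) avoid).
- by apply: le_lt_trans (probability_le1 _ (measurable_avoid 0)) _;
    rewrite ltry.
- exact: measurable_avoid.
- by rewrite -e.
move=> n m nm; apply/subsetPset => w /avoidP h; apply/avoidP => i /andP[i0 im].
by apply: h; rewrite i0 (leq_trans im).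
Qed.

End HittingLaw.

(** * Exit from large balls before the return to a finite set *)

Section Exit.
Context {R : realType} {d : nat} {a : 'rV[int]_d -> 'rV[int]_d -> R} {ce : R}.
Context (Ha : elliptic_weights ce a) (hd : (3 <= d)%N).
Local Notation V := 'rV[int]_d.
Context {disp : measure_display} {T : measurableType disp}
  {P : V -> probability T R} {X : nat -> T -> V} (hX : random_walk a P X).
Context (s : seq V) (us : uniq s).
Implicit Types (x y z v : V).

Let d0 : (0 < d)%N. Proof. exact: leq_trans hd. Qed.
Let A : set V := [set v | v \in s].

Lemma iter_walk_op_far k f c r : (forall x, x \in box c (r + k) -> f x = 0) ->
  forall x, x \in box c r -> iter k (walk_op a predT) f x = 0.
Proof.
move=> hf; elim: k r hf => [|k IH] r hf x xb /=; first by apply: hf;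
  rewrite addn0.
rewrite /walk_op big1_seq // => y /andP[_]; rewrite mem_nbrs => xy.
rewrite (IH r.+1) ?mulr0 //; last exact: box_nneighbour xb xy.
by move=> v vb; apply: hf; rewrite addnS -addSn.
Qed.

Lemma walk_range_negligible z :
  (P z).-negligible [set w | exists j, X j w \notin box z j].
Proof.
have -> : [set w | exists j, X j w \notin box z j] =
    \bigcup_j [set w | X j w \notin box z j].
  by apply/seteqP; split => [w [j hj]|w [j _ hj]]; exists j.
apply: negligible_bigcup => -[|k].
  apply: negligibleS (start_negligible hX z) => w /=.
  by apply: contraNnot => ->; apply: box_center.
have m := measurable_walk hX k.+1 (fun v => v \notin box z k.+1).
apply/(prob_eq0P _ m).
have e : [set w | X k.+1 w \notin box z k.+1] =
    visits X 0 (nseq k xpredT ++ [:: fun v => v \notin box z k.+1]).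
  apply/seteqP; split => [w h i|w h].
    rewrite size_cat size_nseq addn1 ltnS leq_eqVlt => /orP[/eqP ->|ik].
      by rewrite nth_cat size_nseq ltnn subnn add1n.
    by rewrite nth_cat size_nseq ik nth_nseq ik.
  have := h k; rewrite size_cat size_nseq addn1 => /(_ (ltnSn _)).
  by rewrite nth_cat size_nseq ltnn subnn add1n.
rewrite e (prob_visits Ha hX) path_weight_nseq.
apply: (@iter_walk_op_far _ _ z 0); last exact: box_center.
move=> x xb; rewrite path_weight1 /walk_op big1_seq // => y /andP[/negP yb].
by rewrite mem_nbrs => xy; case: yb; apply: box_nneighbour xb xy.
Qed.

Lemma iter_dirac_cvg0 v z :
  iter n (walk_op a predT) (dirac_at v) z @[n --> \oo] --> (0 : R).
Proof.
have h1 := @cvg_green _ _ _ _ Ha hd v z.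
have h2 := h1; rewrite -(cvg_shiftS (fun n => green_sum a n v z)) in h2.
have -> : (fun n => iter n (walk_op a predT) (dirac_at v) z) =
    (fun n => green_sum a n.+1 v z - green_sum a n v z).
  by apply/funext => n; rewrite /green_sum big_nat_recr //= addrAC subrr add0r.
by rewrite -(subrr (green a v z)); apply: cvgB.
Qed.

(** Staying for [n] steps forces the last position into a fixed box, and each P_z(X_n = v) is the
    general term of a convergent Green series. *)
Lemma stay_cvg0 (B : pred V) M z : (forall v, B v -> v \in box 0 M) ->
  path_weight a (nseq n B) z @[n --> \oo] --> (0 : R).
Proof.
move=> hB; rewrite -(cvg_shiftS (fun n => path_weight a (nseq n B) z)).
pose g y : R := \sum_(v <- box 0 M) 1 * dirac_at v y.
have g0 y : 0 <= g y by apply: sumr_ge0 => v _; rewrite mul1r dirac_at_ge0.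
have w0 (S : pred V) y : 0 <= walk_op a S (fun=> 1) y by apply: (walk_op_ge0 Ha
  d0).
have h1 y : path_weight a [:: B] y <= walk_op a predT g y.
  rewrite path_weight1 /walk_op big_mkcond.
  apply: ler_sum => v _; case: ifP => hv; last first.
    by rewrite mulr_ge0 ?(transition_ge0 Ha d0).
  rewrite ler_wpM2l ?(transition_ge0 Ha d0) //.
  apply: (@le_trans _ _ (1 * dirac_at v v));
    first by rewrite mul1r /dirac_at eqxx.
  apply: (@sum_ge_term R _ _ (fun u => 1 * dirac_at u v)); first exact: hB.
  by move=> u _; rewrite mul1r dirac_at_ge0.
apply: (@squeeze_cvgr _ _ _ _ (fun=> 0) (fun n =>
  iter n.+1 (walk_op a predT) g z)).
- apply: nearW => n.
  change (0 <= path_weight a (nseq n.+1 B) z <=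
    iter n.+1 (walk_op a predT) g z).
  apply/andP; split.
    rewrite -[nseq _ _]cats0 path_weight_nseq; apply: (iter_walk_op_ge0 Ha d0).
    by move=> y; rewrite /path_weight.
  have -> : nseq n.+1 B = nseq n B ++ [:: B] by rewrite -(nseqD n 1) (addn1 n).
  rewrite path_weight_nseq iterSr.
  apply: (@le_trans _ _ (iter n (walk_op a predT) (path_weight a [:: B]) z)).
    by apply: (iter_walk_op_leT Ha d0) => y; apply: (w0 B).
  by apply: (iter_walk_op_le Ha d0) => y; apply: h1.
- exact: cvg_cst.
have -> : (fun n => iter n.+1 (walk_op a predT) g z) = (fun n =>
    \sum_(v <- box 0 M) 1 * iter n.+1 (walk_op a predT) (dirac_at v) z).
  by apply/funext => n; rewrite iter_walk_op_sum.
suff h : \sum_(v <- box 0 M) 1 * iter n.+1 (walk_op a predT) (dirac_at v) z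
    @[n --> \oo] --> \sum_(v <- box (0 : V) M) 1 * (0 : R).
  by rewrite [X in _ --> X]big1 in h => // v _; rewrite mulr0.
apply: cvg_sum_seq => v _; apply: cvgMr.
have := @iter_dirac_cvg0 v z.
by rewrite -(cvg_shiftS (fun n => iter n (walk_op a predT) (dirac_at v) z)).
Qed.

Definition exits_first k0 (C : set V) : set T :=
  [set w | (hit_from k0 X C w < tau X A w :> \bar R)%E].

Lemma measurable_exits_first k0 C : measurable (exits_first k0 C).
Proof.
have -> : exits_first k0 C = \bigcup_n [set w | (k0 <= n)%N /\ C (X n w) /\
    forall i, (1 <= i <= n)%N -> ~ A (X i w)].
  apply/seteqP; split => [w /hit_from_ltP [n [h1 h2 h3]]|w [n _ [h1 [h2 h3]]]].
    by exists n.
  by apply/hit_from_ltP; exists n.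
apply: bigcup_measurable => n _.
case: (boolP (k0 <= n)%N) => h; last first.
  by rewrite (_ : [set _ | _] = set0) //; apply/seteqP; split => // w [].
rewrite (_ : [set _ | _] = [set w | C (X n w)] `&`
    [set w | forall i, (1 <= i <= n)%N -> ~ A (X i w)]); last first.
  by apply/seteqP; split => w [] // _ [].
apply: measurableI; first exact: (measurable_walk hX n C).
apply: measurable_forall => i; apply: measurable_imply.
exact: (measurable_walk hX i (fun v => ~ A v)).
Qed.

(* Used with [k0 = 1] for the boundary of the balls [B m] and with [k0 = 0] for
   their complement, as [tau] and [tau_bar] do. *)
Lemma exits_first_cvg k0 (C : nat -> set V) (B : nat -> pred V) z :
  (k0 <= 1)%N ->
  (forall n, \forall m \near \oo, forall x, x \in box z n -> ~ C m x) ->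
  (forall m, exists M, forall v, B m v -> v \in box 0 M) ->
  (\forall m \near \oo, forall n,
    path_weight a (nseq n (fun v => `[< ~ C m v >])) z <=
    path_weight a (nseq n (B m)) z) ->
  prob (P z) (exits_first k0 (C m)) @[m --> \oo] -->
  escape s (hit_prob (P := P) (X := X) s) z.
Proof.
move=> k01 farC finB leB.
set e := escape _ _ _.
(* Almost surely the walk meets [C m], since avoiding it means staying in a bounded set; so if it
   never returns to [s], it meets [C m] before. *)
have lower : \forall m \near \oo, e <= prob (P z) (exits_first k0 (C m)).
  apply: filterS leB => m hm.
  pose N := [set w | forall i, ~ C m (X i.+1 w)].
  have mN : measurable N.
    by apply: measurable_forall => i;
      apply: (measurable_walk hX i.+1 (fun v => ~ C m v)).
  have N0 : prob (P z) N = 0.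
    have [M hM] := finB m.
    apply/eqP; rewrite eq_le prob_ge0 andbT.
    apply: (cvgr_to_ge (stay_cvg0 z hM)); apply: nearW => n.
    apply: le_trans (hm n); rewrite -(prob_visits Ha hX).
    apply: prob_le => //; first exact: (measurable_visits hX).
    move=> w Nw i; rewrite size_nseq nth_nseq => ->; rewrite add1n.
    by apply/asboolP; apply: Nw.
  rewrite /e (escapeE hX us).
  have [mf _] := prob_finite_tau hX us z.
  apply: (prob_le_negligible _ _ (iffLR (prob_eq0P (P z) mN) N0)).
  - exact: measurableC.
  - exact: measurable_exits_first.
  move=> w ntau; have [Nw|] := pselect (N w); first by right.
  move=> /existsNP [i /contrapT Ci]; left; apply/hit_from_ltP; exists i.+1.
  split => //; first exact: leq_trans k01 _.
  by move=> t /andP[t0 _] At; apply: ntau; apply/tau_ltyP; exists t.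
apply/cvgrPdist_lt => eps eps0.
have /cvgrPdist_lt /(_ eps eps0) [n0 _ hn] :=
  @cvg_avoid R d a disp T P X hX s us z.
have := hn n0 (leqnn _); rewrite /= -/e => hav.
have := farC n0; apply: filterS2 lower => m hlow far.
rewrite ltr_distlC.
(* Almost surely [C m] is out of reach during the first [n0] steps, so meeting it before [s] entails
   avoiding [s] up to time [n0]. *)
have up : prob (P z) (exits_first k0 (C m)) <= prob (P z) (avoid (X := X) s n0).
  apply: (prob_le_negligible _ _ (walk_range_negligible z)).
  - exact: measurable_exits_first.
  - exact: (measurable_avoid hX).
  move=> w /hit_from_ltP [t [_ Ct hA]].
  have [[j hj]|hr] := pselect (exists j, X j w \notin box z j).
    by right; exists j.
  left; apply/avoidP => i /andP[i0 it]; apply/negP; apply: hA; rewrite i0 /=.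
  apply: (leq_trans it); rewrite leqNgt; apply/negP => tn.
  apply: (far (X t w)) => //; apply: (box_sub (ltnW tn)).
  by apply/negPn/negP => h; apply: hr; exists t.
move: hav; rewrite ltr_distlC => /andP[_ h2].
apply/andP; split; last exact: le_lt_trans up h2.
by apply: lt_le_trans hlow; rewrite ltrBlDr ltrDl.
Qed.

End Exit.

(** The complement of the boundary of a ball also has an unbounded part, but a walk started in the
    ball cannot reach it without crossing the boundary. *)
Lemma path_weight_stay_le (R : realType) (d : nat)
    (a : 'rV[int]_d -> 'rV[int]_d -> R)
    (ce : R) (C : set 'rV[int]_d) (B : pred 'rV[int]_d) n x :
  elliptic_weights ce a -> (0 < d)%N ->
  (forall x y, B x -> nneighbour x y -> ~ C y -> B y) -> B x ->
  path_weight a (nseq n (fun v => `[< ~ C v >])) x <=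
    path_weight a (nseq n B) x.
Proof.
move=> Ha d0 hB; elim: n x => [|n IH] x Bx //=.
rewrite /walk_op big_mkcond [leRHS]big_mkcond /=; apply: ler_sum_seq => y.
rewrite mem_nbrs => xy; case: ifPn => [/asboolP nCy|_].
  have By := hB x y Bx xy nCy.
  by rewrite By ler_wpM2l ?(transition_ge0 Ha d0) // IH.
case: ifP => // By; rewrite mulr_ge0 ?(transition_ge0 Ha d0) //.
rewrite -[nseq _ _]cats0 path_weight_nseq; apply: (iter_walk_op_ge0 Ha d0) => v.
by rewrite /path_weight.
Qed.

Theorem corollary1p4 (R : realType) (d : nat) (hd : (3 <= d)%N)
    (a : 'rV[int]_d -> 'rV[int]_d -> R)
    (ha_sym : symmetric_weights a) (ha_nn : nn_supported a)
    (ha_ell : uniformly_elliptic a)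
    (disp : measure_display) (T : measurableType disp)
    (P : 'rV[int]_d -> probability T R) (X : nat -> T -> 'rV[int]_d)
    (hX : random_walk a P X)
    (A : set 'rV[int]_d) (hA : finite_set A)
    (y : 'rV[int]_d) (hy : A y) :
  exists l : R,
    [/\ Hbar P X A x y @[x --> tends_to_pinfty (fun x => gdist_set R x A)]
          --> l,
        Hbar P X A x y @[x --> tends_to_pinfty (fun x => (norm1 x)%:~R%:E : \bar R)]
          --> l
      & Hm a P X A m y @[m --> \oo] --> l].
Proof.
have d0 : (0 < d)%N by apply: leq_trans hd.
have [ce ce1 hce] := ha_ell.
have Ha : elliptic_weights ce a.
  by split => // u v uv; have [] := hce u v uv.
have [s us As] : exists2 s : seq 'rV[int]_d, uniq s & A = [set v | v \in s].
  have /finite_seqP[s0 ->] := hA; exists (undup s0); first exact: undup_uniq.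
  by apply/seteqP; split => v /=; rewrite mem_undup.
subst A; have ys : y \in s := hy.
pose e z : R := escape s (hit_prob (P := P) (X := X) s) z.
have e0 z : 0 <= e z by apply: (escape_ge0 hX us).
have cvgH x z : z \in s -> \sum_(0 <= k < n)
    hit_op a (fun v => v \notin s) k z x @[n --> \oo] -->
    hit_prob (P := P) (X := X) s x z.
  by move=> zs; apply: (cvg_hit_prob Ha hX zs).
have D0 : 0 < \sum_(z <- s) vweight a z * e z.
  apply: (escape_sum_gt0 Ha hd us cvgH) => //.
  by apply: contraTneq ys => ->.
have cof :
    Hbar P X [set v | v \in s] x y @[x --> @cofinite_filter 'rV[int]_d] -->
    vweight a y * e y / \sum_(z <- s) vweight a z * e z.
  have := hit_ratio_cvg Ha hd us cvgH ys (fun z _ => e0 z).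
  by under eq_fun => x do rewrite -(HbarE hX us x ys).
have tends (g : 'rV[int]_d -> \bar R) : (forall x, (g x < +oo)%E) ->
    Hbar P X [set v | v \in s] x y @[x --> tends_to_pinfty g] -->
    vweight a y * e y / \sum_(z <- s) vweight a z * e z.
  by move=> hg U /cof; apply: cofinite_tends_to_pinfty.
exists (vweight a y * e y / \sum_(z <- s) vweight a z * e z); split.
- apply: tends => x; apply: (@le_lt_trans _ _ (gdist R x y)).
    by apply: ereal_inf_lbound; exists y.
  by rewrite gdistE ltry.
- by apply: tends => x; apply: ltry.
pose Bm m : pred 'rV[int]_d := fun v => (norm1n v < m)%N.
have finB m : exists M, forall v, Bm m v -> v \in box 0 M.
  exists m => v hv; rewrite mem_box subr0.
  by rewrite (leq_trans (supn_le_norm1n v)) // ltnW.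
have inB m : gball 0 (m%:R : R) =
  [set v : 'rV[int]_d | Bm m v] by apply: gballE.
have far z n : \forall m \near \oo, forall x, x \in box z n -> Bm m x.
  exists (norm1n z + d * n).+1 => // m /= hm x; rewrite mem_box => xb.
  apply: leq_trans hm; rewrite ltnS -[x](subrK z).
  rewrite (leq_trans (norm1nD _ _)) // addnC leq_add2l.
  by rewrite (leq_trans (norm1n_le_supn _)) // leq_mul2l xb orbT.
(* This is where [m] has to be large: the comparison of the staying probabilities needs a start
   inside the ball. *)
have center z : \forall m \near \oo, Bm m z.
  by apply: filterS (far z 0%N) => m; apply; apply: box_center.
have boundary z : prob (P z) (exits_first (R := R) (X := X) s 1
    (gboundary (gball 0 (m%:R : R)))) @[m --> \oo] --> e z.
  apply: (exits_first_cvg Ha hd hX us (B := Bm)) => //.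
    by move=> n; apply: filterS (far z n) => m h x /h xB; rewrite inB => -[].
  apply: filterS (center z) => m zB n;
    apply: (path_weight_stay_le _ Ha) => // u v uB uv nC.
  apply: contrapT => vB; apply: nC; rewrite inB; split => //.
  by exists u.
have complement z : prob (P z) (exits_first (R := R) (X := X) s 0
    (~` gball 0 (m%:R : R))) @[m --> \oo] --> e z.
  apply: (exits_first_cvg Ha hd hX us (B := Bm)) => //.
    by move=> n; apply: filterS (far z n) => m h x /h xB;
      rewrite inB => /(_ xB).
  apply: filterS (center z) => m zB n;
    apply: (path_weight_stay_le _ Ha) => // u v _ _.
  by rewrite inB => /contrapT.
rewrite /Hm; apply: cvgM; first by apply: cvgMr; apply: boundary.
apply: cvgV; first exact: lt0r_neq0.
rewrite /capacity; under eq_fun => m do rewrite -(fsbig_seq _ _ us).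
by apply: cvg_sum_seq => z _; apply: cvgMr; apply: complement.
Qed.
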